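(* Let $\mathcal{A}\subset K[x_1,\ldots,x_n]$ be a $K$-subalgebra that admits a finite Sagbi basis with respect to every global monomial ordering. Let $M_s,M_t\in GL(n,\mathbb{R})$ be matrices, with first rows $\mathbf{w}_s$ and $\mathbf{w}_t$ respectively, such that the matrix orderings $>_s\,:=\,>_{M_s}$ and $>_t\,:=\,>_{M_t}$ are global monomial orderings, and let $S_s$ be a finite (monic) Sagbi basis of $\mathcal{A}$ with respect to $>_s$. Then the following algorithm (whose procedures SagbiBasis, Lift, Interreduce and NextCone are specified in the context) terminates after finitely many steps, and its output $S_{new}$ is a Sagbi basis of $\mathcal{A}$ with respect to $>_t$. Input: $M_s$, $M_t$, $S_s$. Initialization: $M_{old}:=M_s$; $S_{old}:=S_s$; $\mathbf{w}_{new}:=\mathbf{w}_s$; $M_{new}:=(\mathbf{w}_{new},M_t)$; $done:=false$. While $done=false$, do: 1. $In:=In_{\mathbf{w}_{new}}(S_{old})$; 2. $InS:=\mathrm{SagbiBasis}(In,>_{M_{new}})$; 3. $S_{new}:=\mathrm{Lift}(InS,S_{old},In,M_{new},M_{old})$; 4. $S_{new}:=\mathrm{Interreduce}(S_{new},M_{new})$; 5. $u:=\mathrm{NextCone}(S_{new},\mathbf{w}_{new},\mathbf{w}_t)$; 6. if $\mathbf{w}_{new}=\mathbf{w}_t$, then $done:=true$; else $M_{old}:=M_{new}$, $S_{old}:=S_{new}$, $\mathbf{w}_{new}:=(1-u)\mathbf{w}_{new}+u\mathbf{w}_t$, $M_{new}:=(\mathbf{w}_{new},M_t)$. Return $S_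{new}$.
   Context: $K$ is a field. For a subset $G\subset K[x_1,\ldots,x_n]$, $K[G]$ denotes the $K$-subalgebra generated by $G$. A monomial ordering is a total ordering on the monomials $x^\alpha$, $\alpha\in\mathbb{N}^n$, compatible with multiplication; it is global if $x^\alpha>1$ for all $\alpha\ne0$. $LM_>(f)$, $LT_>(f)$, $LC_>(f)$ are the leading monomial, term, coefficient of a nonzero $f$. A subset $S\subset\mathcal{A}$ is a Sagbi basis of the subalgebra $\mathcal{A}$ with respect to $>$ if $in_>(\mathcal{A})=K[L_>(S)]$, where $L_>(G)=\{LM_>(f): f\in G\setminus\{0\}\}$ and $in_>(G)=K[L_>(G)]$. A set is monic if all leading coefficients equal $1$. For $M\in GL(n,\mathbb{R})$, $x^\alpha>_M x^\beta$ iff $M\alpha>M\beta$ in the lexicographic order on $\mathbb{R}^n$. For $\mathbf{w}\in\mathbb{R}^n$, $(\mathbf{w},M_t)$ represents the ordering that first compares $\mathbf{w}$-degrees $deg_{\mathbf{w}}(x^\alpha)=\mathbf{w}\cdot\alpha$ and breaks ties using $>_{M_t}$; this ordering is written $>_{(\mathbf{w},M_t)}$. For $f=\sum a_\alpha x^\alpha\neq 0$, $deg_{\mathbf{w}}(f)=\max\{\mathbf{w}\cdot\alpha: a_\alpha\ne0\}$, and $In_{\mathbf{w}}(f)$ is the sum of all terms $a_\alpha x^\alpha$ of $f$ of maximal $\mathbf{w}$-degree; $In_{\mathbf{w}}(0)=0$. For a set $G$, $In_{\mathbf{w}}(G)=\{In_{\mathbf{w}}(f): f\in G\}$ and $in_{\mathbf{w}}(G)=K[In_{\mathbf{w}}(G)]$.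 Procedures: SagbiBasis$(In,>)$ returns a finite monic Sagbi basis of $K[In]$ with respect to $>$. Lift$(InS,S_{old},In,M_{new},M_{old})$: with $S_{old}=\{g_1,\ldots,g_t\}$ and $InS=\{h_1,\ldots,h_s\}$, express each $h_j$ as $h_j=P_j(In_{\mathbf{w}_{new}}(g_1),\ldots,In_{\mathbf{w}_{new}}(g_t))$ with $P_j\in K[y_1,\ldots,y_t]$, and return $\{\overline h_1,\ldots,\overline h_s\}$ with $\overline h_j=P_j(g_1,\ldots,g_t)$. Interreduce$(G,M)$ takes a given set of polynomials and interreduces it with respect to the ordering represented by $M$. A set $G$ is interreduced with respect to $>$ if $0\notin G$ and $LM_>(f)\notin K[L_>(G\setminus\{f\})]$ for every $f\in G$. NextCone$(S,\mathbf{w},\mathbf{w}_t)$: write the (monic) elements of $S$ as $x^{\alpha(i)}+\sum_\beta c_{i,\beta}x^\beta$, where $x^{\alpha(i)}$ is the leading monomial with respect to the current ordering $>_{M_{new}}$, and let $v_1,\ldots,v_m$ be the vectors $\alpha(i)-\beta$ with $c_{i,\beta}\neq0$. Set $u_{last}:=1$. For $j=1,\ldots,m$: if $\mathbf{w}_t\cdot v_j<0$, put $u_j:=\dfrac{\mathbf{w}\cdot v_j}{\mathbf{w}\cdot v_j-\mathbf{w}_t\cdot v_j}$, and if $u_j<u_{last}$ put $u_{last}:=u_j$. Return $u_{last}$.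
   Formalization: In Lift, each P_j may only contain monomials y^a with sum a_i deg_w(g_i) <= deg_w(h_j), since for arbitrary P_j the claim fails; Interreduce is read as finitely many subduction steps (results made monic, zeros dropped) ending in an interreduced set. *)

(* Defs.v *)
From HB Require Import structures.
From Stdlib Require Export Relation_Operators.
From mathcomp Require Export all_boot all_order all_algebra.
From mathcomp Require Export finmap mpoly.
From mathcomp Require Export boolp classical_sets reals.

Set Implicit Arguments.
Unset Strict Implicit.
Unset Printing Implicit Defensive.

Import Order.TTheory GRing.Theory Num.Theory.
Local Open Scope ring_scope.
Local Open Scope classical_set_scope.

Section Subalgebras.
Variables (n : nat) (K : fieldType).
Implicit Types A G : set {mpoly K[n]}.

Definition subalgebra A : Prop :=
  GRing.subalg_closed (fun f : {mpoly K[n]} => f \in A).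

(* K[G] *)
Definition gen_alg G : set {mpoly K[n]} := smallest subalgebra G.

End Subalgebras.

Section MonomialOrderings.
Variable n : nat.

(* [gt a b] reads x^a > x^b. *)
Definition monomial_ordering (gt : rel 'X_{1..n}) : Prop :=
  [/\ irreflexive gt, transitive gt,
      forall a b, a != b -> gt a b || gt b a
    & forall a b c, gt a b -> gt (a + c)%MM (b + c)%MM].

Definition global_ordering (gt : rel 'X_{1..n}) : Prop :=
  monomial_ordering gt /\ (forall a, a != 0%MM -> gt a 0%MM).

Variable R : realType.

Definition expvec (a : 'X_{1..n}) : 'cV[R]_n := \col_i (a i)%:R.

(* [m] need not be [n], since (w, M) has one more row than M. *)
Definition mxgt m (M : 'M[R]_(m, n)) : rel 'X_{1..n} := fun a b =>
  ([tuple (M *m expvec b) i 0 | i < m] < [tuple (M *m expvec a) i 0 | i < m]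
     :> m.-tuplelexi R)%O.

Definition wgt (w : 'rV[R]_n) (M : 'M[R]_n) : rel 'X_{1..n} :=
  mxgt (col_mx w M).

End MonomialOrderings.

Section SagbiBases.
Variables (n : nat) (K : fieldType) (gt : rel 'X_{1..n}).
Implicit Types (f : {mpoly K[n]}) (A G S : set {mpoly K[n]}).

(* The library's [mlead] is tied to one fixed ordering. By convention LM 0 is
   the exponent 0, and so LC 0 = 0. *)
Definition LM f : 'X_{1..n} :=
  head 0%MM [seq a <- msupp f | all (fun b => (b == a) || gt a b) (msupp f)].

Definition LC f : K := f@_(LM f).

(* L_>(G) *)
Definition LMset G : set {mpoly K[n]} :=
  [set 'X_[LM f] | f in [set f | G f /\ f != 0]].

(* in_>(G) *)
Definition init_alg G : set {mpoly K[n]} := gen_alg (LMset G).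

Definition sagbi_basis A S : Prop :=
  S `<=` A /\ init_alg A = gen_alg (LMset S).

Definition monic_set S : Prop := forall f, S f -> LC f = 1.

End SagbiBases.

Section Weights.
Variables (n : nat) (K : fieldType) (R : realType) (w : 'rV[R]_n).
Implicit Types f : {mpoly K[n]}.

Definition wdegm (a : 'X_{1..n}) : R := (w *m expvec R a) 0 0.

(* The seed [wdegm (mlead f)] is itself one of the compared values if f != 0. *)
Definition wdeg f : R :=
  \big[Num.max/wdegm (mlead f)]_(a <- msupp f) wdegm a.

(* In_w(f) *)
Definition Inw f : {mpoly K[n]} :=
  \sum_(a <- msupp f | wdegm a == wdeg f) f@_a *: 'X_[a].

End Weights.

(* The procedures are nondeterministic (their specification does not determine
   their output), hence relations between arguments and possible outputs. *)
Section Procedures.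
Variables (n : nat) (K : fieldType) (R : realType).
Local Notation poly := {mpoly K[n]}.
Implicit Types (gt : rel 'X_{1..n}) (w : 'rV[R]_n) (G S : {fset poly}).

Definition SagbiBasis (In : {fset poly}) gt (InS : {fset poly}) : Prop :=
  sagbi_basis gt (gen_alg [set` In]) [set` InS] /\ monic_set gt [set` InS].

(* The bound on the weights of the monomials y^a of P: an element of S has
   more terms than its initial form, so terms of P of weight above deg_w(h),
   although they cancel after y_i := In_w(g_i), could survive after y_i := g_i
   and spoil In_w(hbar) = In_w(h). Such terms are never needed, because
   In_w(g_i) is w-homogeneous. *)
Definition lift_of w S (h hbar : poly) : Prop :=
  exists P : {mpoly K[size S]},
    [/\ h = P \mPo map_tuple (Inw w) (in_tuple S),
        forall a, a \in msupp P ->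
          \sum_(i < size S) wdeg w (tnth (in_tuple S) i) *+ a i <= wdeg w h
      & hbar = P \mPo in_tuple S].

Definition Lift (InS S : {fset poly}) w (Snew : {fset poly}) : Prop :=
  exists l : poly -> poly,
    (forall h, h \in InS -> lift_of w S h (l h)) /\
    Snew = [fset l h | h in InS]%fset.

Definition interreduced gt G : Prop :=
  0 \notin G /\
  forall f, f \in G ->
    ~ gen_alg (LMset gt [set` (G `\ f)%fset]) 'X_[LM gt f].

(* One subduction step: a term (leading or not) of some f in G, whose monomial
   is the leading monomial of a power product p of the other elements, is
   cancelled using p; the result is made monic, or dropped if it is 0. *)
Definition subduction_step gt G G' : Prop :=
  exists (f : poly) (e : poly -> nat),
    let p := \prod_(g <- (G `\ f)%fset) g ^+ e g in
    let r := f - (f@_(LM gt p) / LC gt p) *: p in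
    [/\ f \in G, LM gt p \in msupp f
      & G' = (((LC gt r)^-1 *: r |` (G `\ f)) `\ 0)%fset].

Definition Interreduce gt G G' : Prop :=
  clos_refl_trans _ (subduction_step gt) (G `\ 0)%fset G' /\
  interreduced gt G'.

Definition cone_vectors gt S : seq 'cV[R]_n :=
  [seq expvec R (LM gt f) - expvec R b
     | f <- S, b <- [seq b <- msupp f | b != LM gt f]].

Definition NextCone gt S w (wt : 'rV[R]_n) : R :=
  foldl (fun ulast v =>
           let d := (w *m v) 0 0 in
           let dt := (wt *m v) 0 0 in
           if dt < 0 then
             let u := d / (d - dt) in if u < ulast then u else ulast
           else ulast)
        1 (cone_vectors gt S).

End Procedures.

Section Walk.
Variables (n : nat) (K : fieldType) (R : realType).
Variable Mt : 'M[R]_n.+1.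
Local Notation poly := {mpoly K[n.+1]}.

(* [Running S w] is the state S_old = S, w_new = w at the loop test with
   done = false. M_new is always (w_new, M_t), and no procedure's specification
   depends on M_old. *)
Variant state : Type :=
  | Running of {fset poly} & 'rV[R]_n.+1
  | Returned of {fset poly}.

Definition loop_body (Sold : {fset poly}) (w : 'rV[R]_n.+1)
    (Snew : {fset poly}) : Prop :=
  let gt := wgt w Mt in
  exists InS S1 : {fset poly},
    [/\ SagbiBasis [fset Inw w f | f in Sold]%fset gt InS,
        Lift InS Sold w S1
      & Interreduce gt S1 Snew].

Variant step : state -> state -> Prop :=
  | StepDone S w S' : loop_body S w S' -> w = row 0 Mt ->
      step (Running S w) (Returned S')
  | StepNext S w S' : loop_body S w S' -> w <> row 0 Mt ->
      let u := NextCone (wgt w Mt) S' w (row 0 Mt) in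
      step (Running S w) (Running S' ((1 - u) *: w + u *: row 0 Mt)).

Definition reachable : state -> state -> Prop := clos_refl_trans _ step.

(* Every execution from [st] is finite. *)
Definition terminates (st : state) : Prop := Acc (fun y x => step x y) st.

End Walk.

(* Main.v *)
Require Import Defs.
From mathcomp Require Import ring lra.

Set Implicit Arguments.
Unset Strict Implicit.
Unset Printing Implicit Defensive.

Import Order.TTheory GRing.Theory Num.Theory.
Local Open Scope ring_scope.
Local Open Scope classical_set_scope.

(** Write [W t = (1 - t) ws + t wt] for the segment from the first row of the
    source matrix to the first row of the target matrix. Along every execution
    the current weight is [W t] for some [t], and [t] increases strictly.

    Correctness rests on one invariant: the current set S is a Sagbi basis of A
    for some global ordering that refines the current weight w. Subduction with
    respect to that ordering preserves the filtration by w-degree, so that every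
    initial form In_w(f), with f in A, lies in K[In_w(S)] ([Inw_gen]). Hence a
    Sagbi basis of K[In_w(S)] for (w, Mt) has the leading monomials of A, and
    lifting does not change leading monomials because the lift has the same
    initial form ([Inw_lift], [lifted_sagbi]). Interreduction consists of
    subductions by elements of A, which keep a Sagbi basis ([subduction_sagbi]).
    At the new weight w', no tail term of the new basis has passed its leading
    monomial, so the leading monomials stay the same for the ordering that
    compares w' first and then (w, Mt). That suffices: if the leading monomials
    of the elements of S agree for two global orderings and S is a Sagbi basis
    for one, then it is one for the other ([sagbi_transfer]), because the
    monomials outside the initial algebra represent a basis of the quotient
    K[x]/A for either ordering. At the end w is the first row of Mt and (w, Mt)
    is the target ordering itself.

    Every procedure has an output: a finite Sagbi basis T of A for (w, Mt)
    exists by hypothesis and its initial forms are a Sagbi basis of K[In_w(S)];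
    a lifting polynomial exists since elements of K[In_w(S)] are polynomials in
    the initial forms, whose terms of too large weight can be dropped; and a
    redundant element of a Sagbi basis can be subducted to zero by the others.

    For termination, suppose that an infinite execution exists, and let x be the
    supremum of the parameters t of the states with one. As t tends to x from
    below, the orderings (W t, Mt) converge to the global ordering that compares
    by W x, then by ws - wt, then by Mt. A finite Sagbi basis T of A for the
    limit keeps its leading monomials for all t close to x, hence is a Sagbi
    basis for all these orderings. The leading monomials of an interreduced
    Sagbi basis are determined by the initial algebra, so those of all bases
    computed near x come from the finite set of leading monomials of T. The next
    parameter is always a value where a leading monomial and a tail term of the
    current basis have equal weight. Such a tail term has bounded weight for an
    interior point of the segment, and only finitely many such values exist
    ([finitely_many_walls]); but the parameters ascend strictly without end. *)

(** * Subalgebras and monomial algebras *)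

Section SubalgebraTheory.
Variables (n : nat) (K : fieldType).
Local Notation poly := {mpoly K[n]}.
Implicit Types (A G : set poly) (f g : poly).

Lemma subalgebraP A :
  subalgebra A <-> [/\ A 1, forall c f g, A f -> A g -> A (c *: f + g)
                     & forall f g, A f -> A g -> A (f * g)].
Proof.
split=> -[A1 AZ AM]; split.
- by move: A1; rewrite unfold_in => /asboolP.
- by move=> c f g Af Ag; have := AZ c f g; rewrite !unfold_in => H; apply/asboolP/H; apply/asboolP.
- by move=> f g Af Ag; have := AM f g; rewrite !unfold_in => H; apply/asboolP/H; apply/asboolP.
- by rewrite unfold_in; apply/asboolP.
- by move=> c f g; rewrite !unfold_in => /asboolP Af /asboolP Ag; apply/asboolP/AZ.
- by move=> f g; rewrite !unfold_in => /asboolP Af /asboolP Ag; apply/asboolP/AM.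
Qed.

Section Closure.
Variables (A : set poly) (Aalg : subalgebra A).

Lemma subalg1 : A 1. Proof. by case/subalgebraP: Aalg. Qed.

Lemma subalgM f g : A f -> A g -> A (f * g).
Proof. by case/subalgebraP: Aalg => _ _; apply. Qed.

Lemma subalgZD c f g : A f -> A g -> A (c *: f + g).
Proof. by case/subalgebraP: Aalg => _ + _; apply. Qed.

Lemma subalg0 : A 0.
Proof. by rewrite -(subrr 1) addrC -scaleN1r; apply: subalgZD subalg1 subalg1. Qed.

Lemma subalgZ c f : A f -> A (c *: f).
Proof. by move=> Af; rewrite -[_ *: _]addr0; apply: subalgZD Af subalg0. Qed.

Lemma subalgD f g : A f -> A g -> A (f + g).
Proof. by move=> Af Ag; rewrite -[f]scale1r; apply: subalgZD. Qed.

Lemma subalgB f g : A f -> A g -> A (f - g).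
Proof. by move=> Af Ag; rewrite addrC -scaleN1r; apply: subalgZD. Qed.

Lemma subalgX f k : A f -> A (f ^+ k).
Proof.
by move=> Af; elim: k => [|k IH]; [exact: subalg1 | rewrite exprS; apply: subalgM].
Qed.

Lemma subalg_prod (I : eqType) (r : seq I) (F : I -> poly) :
  (forall i, i \in r -> A (F i)) -> A (\prod_(i <- r) F i).
Proof.
move=> AF; rewrite big_seq.
by elim/big_rec: _ => [|i f /AF Ai Af]; [exact: subalg1 | exact: subalgM].
Qed.

Lemma subalg_sum (I : eqType) (r : seq I) (F : I -> poly) :
  (forall i, i \in r -> A (F i)) -> A (\sum_(i <- r) F i).
Proof.
move=> AF; rewrite big_seq.
by elim/big_rec: _ => [|i f /AF Ai Af]; [exact: subalg0 | exact: subalgD].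
Qed.

End Closure.

Lemma gen_alg_subalg G : subalgebra (gen_alg G).
Proof.
apply/subalgebraP; split=> [|c f g Gf Gg|f g Gf Gg] B /= [Balg GB].
- exact: subalg1.
- by apply: subalgZD => //; [apply: Gf | apply: Gg].
- by apply: subalgM => //; [apply: Gf | apply: Gg].
Qed.

Lemma sub_gen_alg G : G `<=` gen_alg G.
Proof. exact: sub_gen_smallest. Qed.

Lemma gen_alg_min A G : subalgebra A -> G `<=` A -> gen_alg G `<=` A.
Proof. exact: smallest_sub. Qed.

Lemma gen_alg_sub G G' : G `<=` gen_alg G' -> gen_alg G `<=` gen_alg G'.
Proof. by apply: gen_alg_min; exact: gen_alg_subalg. Qed.

End SubalgebraTheory.

Section MonomialSpan.
Variable n : nat.
Implicit Types (L : set 'X_{1..n}) (a b : 'X_{1..n}).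

Inductive mspan L : set 'X_{1..n} :=
  | mspan0 : mspan L 0%MM
  | mspanS a b : L a -> mspan L b -> mspan L (a + b)%MM.

Lemma mspan_mem L a : L a -> mspan L a.
Proof. by move=> La; rewrite -[a]addm0; apply: mspanS La (mspan0 _). Qed.

Lemma mspanD L a b : mspan L a -> mspan L b -> mspan L (a + b)%MM.
Proof.
move=> + Lb; elim=> [|c d Lc _ IH]; first by rewrite add0m.
by rewrite -addmA; apply: mspanS.
Qed.

Lemma mspan_sub L L' : L `<=` mspan L' -> mspan L `<=` mspan L'.
Proof.
move=> LL' m; elim=> [|a b /LL' L'a _ IH]; first exact: mspan0.
exact: mspanD.
Qed.

(** The polynomials supported in a submonoid of exponents form a subalgebra. Through
    this, membership in an algebra of leading monomials becomes a question about
    exponent vectors. *)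
Lemma gen_alg_monomialsP (K : fieldType) L (f : {mpoly K[n]}) :
  gen_alg [set 'X_[a] | a in L] f <-> forall a, a \in msupp f -> mspan L a.
Proof.
split.
  pose B := [set g : {mpoly K[n]} | forall a, a \in msupp g -> mspan L a].
  suff /(_ f) : gen_alg [set 'X_[a] | a in L] `<=` B by [].
  apply: gen_alg_min => [|_ [a La <-] b /mem_msuppXP <-]; last exact: mspan_mem.
  apply/subalgebraP; split=> [a|c g h Bg Bh a|g h Bg Bh a].
  - by rewrite msupp1 inE => /eqP ->; exact: mspan0.
  - by move/msuppD_le; rewrite mem_cat => /orP [/msuppZ_le /Bg|/Bh].
  - by move/msuppM_le/allpairsP => [[b c] /= [/Bg Lb /Bh Lc ->]]; exact: mspanD.
move=> Lf; have gS := gen_alg_subalg [set 'X_[K, a] | a in L].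
rewrite [f]mpolyE; apply: (subalg_sum gS) => a /Lf La; apply: (subalgZ gS).
elim: La => [|b c Lb _ IH]; first by rewrite mpolyX0; exact: (subalg1 gS).
by rewrite mpolyXD; apply: (subalgM gS) => //; apply: sub_gen_alg; exists b.
Qed.

End MonomialSpan.

(** * Leading monomials *)

Section MonomialOrderingTheory.
Variables (n : nat) (gt : rel 'X_{1..n}).
Hypothesis gtmo : monomial_ordering gt.
Implicit Types a b c : 'X_{1..n}.

Lemma mo_irr a : gt a a = false. Proof. by case: gtmo => ->. Qed.

Lemma mo_trans a b c : gt a b -> gt b c -> gt a c.
Proof. by case: gtmo => _ tr _ _; apply: tr. Qed.

Lemma mo_asym a b : gt a b -> gt b a = false.
Proof. by move=> ab; apply/negP => /(mo_trans ab); rewrite mo_irr. Qed.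

Lemma mo_addr a b c : gt a b -> gt (a + c)%MM (b + c)%MM.
Proof. by case: gtmo => _ _ _; apply. Qed.

Lemma mo_addl a b c : gt a b -> gt (c + a)%MM (c + b)%MM.
Proof. by rewrite ![(c + _)%MM]addmC; exact: mo_addr. Qed.

Lemma mo_total a b : a != b -> gt a b || gt b a.
Proof. by case: gtmo => _ _ + _; apply. Qed.

Section Leading.
Variable K : fieldType.
Implicit Types f g : {mpoly K[n]}.

Lemma LM_unique f a :
  a \in msupp f -> (forall b, b \in msupp f -> b != a -> gt a b) -> LM gt f = a.
Proof.
move=> fa amax; rewrite /LM; set s := filter _ _.
have sP b : b \in s = (b == a).
  rewrite mem_filter; apply/andP/eqP => [[/allP /(_ a fa)]|->]; last first.
    split=> //; apply/allP => d fd; have [//|/= da] := eqVneq d a; exact: amax.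
  case/orP => [/eqP ->//|gtba fb]; apply/eqP; apply: contraTT gtba => ba.
  by rewrite mo_asym // amax.
case: s sP => [|b s] sP; first by have := sP a; rewrite eqxx.
by apply/eqP; rewrite -sP /= mem_head.
Qed.

Lemma LM_max f : f != 0 ->
  LM gt f \in msupp f /\ forall b, b \in msupp f -> b != LM gt f -> gt (LM gt f) b.
Proof.
move=> f0; suff [a fa amax] : exists2 a, a \in msupp f &
    forall b, b \in msupp f -> b != a -> gt a b.
  by rewrite (LM_unique fa amax).
have : msupp f != [::] by rewrite msupp_eq0.
elim: (msupp f) => // a [|b s] IH _.
  by exists a; rewrite ?mem_head // => d; rewrite inE => /eqP ->; rewrite eqxx.
have [//|c cs cmax] := IH; have [ac|ac] := eqVneq a c.
  exists c; first by rewrite inE cs orbT.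
  by move=> d; rewrite inE => /orP [/eqP ->|]; [rewrite ac eqxx|exact: cmax].
case/orP: (mo_total ac) => gtac.
  exists a; first exact: mem_head.
  move=> d; rewrite inE => /orP [/eqP ->|]; first by rewrite eqxx.
  have [-> //|dc /cmax gtcd _] := eqVneq d c.
  by apply: mo_trans gtac (gtcd dc).
exists c; first by rewrite inE cs orbT.
by move=> d; rewrite inE => /orP [/eqP ->//|]; exact: cmax.
Qed.

Lemma LM_supp f : f != 0 -> LM gt f \in msupp f. Proof. by case/LM_max. Qed.

Lemma LM_gt f b : b \in msupp f -> b != LM gt f -> gt (LM gt f) b.
Proof.
have [->|/LM_max [_]] := eqVneq f 0; first by rewrite -[0]mpolyC0 msupp0.
exact.
Qed.

Lemma LC_neq0 f : f != 0 -> LC gt f != 0.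
Proof. by move/LM_supp; rewrite mcoeff_msupp. Qed.

Lemma LMZ (c : K) f : c != 0 -> LM gt (c *: f) = LM gt f.
Proof.
move=> c0; have [->|f0] := eqVneq f 0; first by rewrite scaler0.
have sZ b : (b \in msupp (c *: f)) = (b \in msupp f).
  by rewrite !mcoeff_msupp mcoeffZ mulf_eq0 (negbTE c0).
by apply: LM_unique => [|b]; rewrite sZ; [exact: LM_supp|exact: LM_gt].
Qed.

Lemma LCZ (c : K) f : LC gt (c *: f) = c * LC gt f.
Proof.
have [->|c0] := eqVneq c 0; last by rewrite /LC LMZ // mcoeffZ.
by rewrite scale0r mul0r /LC mcoeff0.
Qed.

(** Compatibility of the ordering with addition leaves a single pair of exponents
    that contributes to the coefficient at [a + b]. *)
Lemma mcoeffM_top f g a b :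
  (forall c, c \in msupp f -> c != a -> gt a c) ->
  (forall c, c \in msupp g -> c != b -> gt b c) ->
  (f * g)@_(a + b) = f@_a * g@_b.
Proof.
move=> fa gb.
have top c d : c \in msupp f -> d \in msupp g -> (a + b = c + d)%MM -> c = a /\ d = b.
  move=> fc gd abE; have [ca|/(fa _ fc) gtac] := eqVneq c a.
    by split=> //; apply: (@addmI _ a); rewrite abE ca.
  have [db|/(gb _ gd) gtbd] := eqVneq d b.
    by move: (mo_addr b gtac); rewrite abE db mo_irr.
  by have := mo_trans (mo_addr b gtac) (mo_addl c gtbd); rewrite abE mo_irr.
rewrite mcoeffM.
have aP : (mdeg a < (mdeg (a + b)).+1)%N by rewrite mdegD ltnS leq_addr.
have bP : (mdeg b < (mdeg (a + b)).+1)%N by rewrite mdegD ltnS leq_addl.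
rewrite (bigD1 (BMultinom aP, BMultinom bP)) //= big1 ?addr0 // => -[c d] /=.
case/andP => /eqP abE ne; apply/eqP; rewrite mulf_eq0 !mcoeff_eq0 -negb_and.
apply: contra ne => /andP [fc gd]; have [ca db] := top _ _ fc gd abE.
by rewrite xpair_eqE -!val_eqE /= ca db !eqxx.
Qed.

Lemma LMM f g : f != 0 -> g != 0 -> LM gt (f * g) = (LM gt f + LM gt g)%MM.
Proof.
move=> f0 g0; apply: LM_unique => [|c].
  rewrite mcoeff_msupp (mcoeffM_top (@LM_gt f) (@LM_gt g)).
  by rewrite mulf_neq0 ?LC_neq0.
move/msuppM_le/allpairsP => [[a b] /= [fa gb ->]] ne.
have [aE|/(LM_gt fa) gta] := eqVneq a (LM gt f).
  have [bE|/(LM_gt gb)] := eqVneq b (LM gt g); first by rewrite aE bE eqxx in ne.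
  by rewrite aE; apply: mo_addl.
have [->|/(LM_gt gb) gtb] := eqVneq b (LM gt g); first exact: mo_addr.
exact: mo_trans (mo_addr _ gta) (mo_addl _ gtb).
Qed.

Lemma LM1 : LM gt (1 : {mpoly K[n]}) = 0%MM.
Proof. by apply: LM_unique => [|b]; rewrite msupp1 inE // => ->. Qed.

(** When [LM gt p = LM gt f], the second alternative of the conclusion and [LM_gt]
    put all surviving terms strictly below [LM gt f]: each reduction below descends
    for this reason. *)
Lemma cancel_LM f p b :
  p != 0 -> b \in msupp (f - (f@_(LM gt p) / LC gt p) *: p) ->
  b != LM gt p /\ (b \in msupp f \/ gt (LM gt p) b).
Proof.
move=> p0 bs; have bp : b != LM gt p.
  apply: contraTneq bs => ->; rewrite mcoeff_msupp mcoeffB mcoeffZ.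
  by rewrite divfK ?subrr ?eqxx ?LC_neq0.
split=> //; move/msuppB_le: bs; rewrite mem_cat => /orP [|/msuppZ_le pb]; first by left.
by right; apply: LM_gt.
Qed.

End Leading.
End MonomialOrderingTheory.

(** * Global orderings are well-founded *)

Section Dickson.
Variable n : nat.

(** Jump each time to a place where the minimum of the remaining tail is attained. *)
Lemma nat_nondecreasing_subseq (v : nat -> nat) :
  exists2 phi : nat -> nat, {homo phi : i j / (i < j)%N} &
    {homo v \o phi : i j / (i <= j)%N}.
Proof.
have minP k : exists j, (k <= j)%N /\ forall i, (k <= i)%N -> (v j <= v i)%N.
  suff: exists m, exists2 j, (k <= j)%N & v j = m /\ forall i, (k <= i)%N -> (m <= v i)%N.
    by case=> m [j kj [<- jmin]]; exists j.
  pose P m := `[< exists2 j, (k <= j)%N & v j = m >].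
  have exP : exists m, P m by exists (v k); apply/asboolP; exists k.
  case: (ex_minnP exP) => m /asboolP [j kj jm] mmin; exists m, j => //; split=> // i ki.
  by apply: mmin; apply/asboolP; exists i.
have [mu muP] := choice minP.
pose phi := fix phi k := if k is k'.+1 then mu (phi k').+1 else mu 0%N.
have phiS k : (phi k < phi k.+1)%N by have [] := muP (phi k).+1.
have phi_lt : {homo phi : i j / (i < j)%N} by apply: homo_ltn => //; exact: ltn_trans.
exists phi => //; apply: homo_leq => [i|i j k|i] /=; [exact: leqnn|exact: leq_trans|].
have phi_min k i0 : (phi k <= i0)%N -> (v (phi k) <= v i0)%N.
  by case: k => [|k] le0; apply: (muP _).2; apply: leq_trans le0 => //; have [] := muP (phi k).+1.
by apply/phi_min/ltnW.
Qed.

(** Extract a subsequence that is nondecreasing in one more coordinate, for each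
    coordinate in turn. *)
Lemma dickson (u : nat -> 'X_{1..n}) : exists i j, (i < j)%N /\ (u i <= u j)%MM.
Proof.
suff [phi phi_lt phi_le] : exists2 phi : nat -> nat, {homo phi : i j / (i < j)%N} &
    forall c, c \in enum 'I_n -> {homo (fun k => u (phi k) c) : i j / (i <= j)%N}.
  exists (phi 0%N), (phi 1%N); split; first exact: phi_lt.
  by apply/mnm_lepP => c; apply: phi_le; rewrite ?mem_enum.
elim: (enum 'I_n) => [|c s [phi phi_lt phi_le]]; first by exists id.
have [psi psi_lt psi_le] := nat_nondecreasing_subseq (fun k => u (phi k) c).
exists (phi \o psi) => [i j /psi_lt /phi_lt //|d].
rewrite inE => /orP [/eqP ->|/phi_le dle] i j ij; first exact: psi_le.
by apply: dle; move: ij; rewrite leq_eqVlt => /predU1P [->//|/psi_lt /ltnW].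
Qed.

Variable gt : rel 'X_{1..n}.
Hypothesis gtglobal : global_ordering gt.
Let gtmo : monomial_ordering gt := gtglobal.1.

(** In a descending sequence, Dickson's lemma finds a later exponent that is a sum
    of an earlier one and some exponent, hence is not smaller for a global ordering. *)
Lemma global_wf : well_founded (fun b a => gt a b).
Proof.
move=> a; apply: contrapT => aN.
pose bad := {b | ~ Acc (fun b a => gt a b) b}.
have /choice [next nextP] : forall b : bad, exists c : bad, gt (sval b) (sval c).
  move=> [b bN] /=; apply: contrapT => noc; apply: bN; constructor => c gtbc.
  by apply: contrapT => cN; apply: noc; exists (exist _ c cN).
pose u k := sval (iter k next (exist _ a aN)).
have u_gt : {homo u : i j / (i < j)%N >-> gt i j}.
  apply: homo_ltn => [y x z|i]; [exact: (mo_trans gtmo)|exact: nextP].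
have [i [j [ij /submK le_ij]]] := dickson u.
have := u_gt _ _ ij; rewrite -le_ij.
have [->|d0] := eqVneq (u j - u i)%MM 0%MM; first by rewrite add0m mo_irr.
move=> gti; have := mo_trans gtmo gti (mo_addr gtmo (u i) (gtglobal.2 _ d0)).
by rewrite add0m mo_irr.
Qed.

(** Induction on the leading monomial. The induction hypothesis asks for all terms
    of [g] to be below [LM gt f] instead of comparing leading monomials, so that
    [g = 0] is included although [LM gt 0] is a conventional value. *)
Lemma lead_ind (K : fieldType) (P : {mpoly K[n]} -> Prop) :
  P 0 ->
  (forall f, f != 0 -> (forall g, (forall b, b \in msupp g -> gt (LM gt f) b) -> P g) ->
     P f) ->
  forall f, P f.
Proof.
move=> P0 PS f; have [->//|f0] := eqVneq f 0.
suff: forall m g, g != 0 -> LM gt g = m -> P g by apply; first exact: f0.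
elim/(well_founded_ind global_wf) => m IH g g0 gm.
apply: PS => // h hlt; have [->//|h0] := eqVneq h 0.
by apply: (IH (LM gt h)) => //; rewrite -gm; apply/hlt/(LM_supp gtmo).
Qed.

End Dickson.

(** * Sagbi bases and subduction *)

Section SagbiTheory.
Variables (n : nat) (K : fieldType).
Local Notation poly := {mpoly K[n]}.
Implicit Types (gt : rel 'X_{1..n}) (A S : set poly) (f g p : poly).

Definition lmons gt S : set 'X_{1..n} := [set LM gt f | f in [set f | S f /\ f != 0]].

Lemma LMsetE gt S : LMset gt S = [set 'X_[a] | a in lmons gt S].
Proof. by rewrite /LMset /lmons image_comp. Qed.

Lemma gen_LMsetP gt S a : gen_alg (LMset gt S) 'X_[a] <-> mspan (lmons gt S) a.
Proof.
rewrite LMsetE; split=> [/gen_alg_monomialsP|Sa]; first by apply; rewrite msuppX mem_head.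
by apply/gen_alg_monomialsP => b /mem_msuppXP <-.
Qed.

(** Both initial algebras are spanned by monomials, so their equality only says that
    the leading monomials of [A] are sums of those of [S]. *)
Lemma sagbiP gt A S :
  sagbi_basis gt A S <->
  S `<=` A /\ forall f, A f -> f != 0 -> mspan (lmons gt S) (LM gt f).
Proof.
split=> -[SA H]; split=> //.
  move=> f Af f0; apply/gen_LMsetP; rewrite -H; apply: sub_gen_alg.
  by exists f.
apply/seteqP; split; apply: gen_alg_sub => _ [f [Af f0] <-].
  by apply/gen_LMsetP/H.
by apply: sub_gen_alg; exists f => //; split=> //; exact: SA.
Qed.

(** A power product of elements of [S] realizes each sum of their leading monomials.
    The property [Q] is what a caller needs to know of that product besides: that it
    lies in [A], or also where its initial form lies. *)
Lemma span_product gt S (Q : poly -> Prop) m :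
  monomial_ordering gt -> Q 1 -> (forall f g, Q f -> Q g -> Q (f * g)) ->
  (forall g, S g -> Q g) -> mspan (lmons gt S) m ->
  exists p, [/\ Q p, p != 0 & LM gt p = m].
Proof.
move=> gtmo Q1 QM QS; elim=> [|_ b [g [Sg g0] <-] _ [p [Qp p0 <-]]].
  by exists 1; split; rewrite ?oner_neq0 ?LM1.
by exists (g * p); rewrite mulf_neq0 // LMM //; split=> //; apply: QM => //; exact: QS.
Qed.

Section Transfer.
Variables (gt : rel 'X_{1..n}) (A S : set poly).
Hypotheses (gtglobal : global_ordering gt) (Aalg : subalgebra A) (SA : S `<=` A).
Let gtmo : monomial_ordering gt := gtglobal.1.

(** A leading term in the span is cancelled by an element of [A], any other one is
    moved to [r]; the rest has a smaller leading monomial. *)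
Lemma normal_form m f : (forall b, b \in msupp f -> gt m b) ->
  exists2 r, A (f - r) &
    forall b, b \in msupp r -> ~ mspan (lmons gt S) b /\ gt m b.
Proof.
elim/(lead_ind gtglobal): f m => [m _|f f0 IH m fm].
  by exists 0 => [|b]; rewrite ?subr0; [exact: subalg0|rewrite -[0]mpolyC0 msupp0].
have mf : gt m (LM gt f) by apply/fm/LM_supp.
have step p : p != 0 -> LM gt p = LM gt f ->
    exists2 r, A (f - (LC gt f / LC gt p) *: p - r) &
      forall b, b \in msupp r -> ~ mspan (lmons gt S) b /\ gt (LM gt f) b.
  move=> p0 pf; set g := f - _.
  suff glt b : b \in msupp g -> gt (LM gt f) b by apply: (IH _ glt).
  rewrite {}/g /LC -{1}pf.
  by case/(cancel_LM gtmo p0); rewrite pf => bf [fb|//]; apply: LM_gt.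
have [Lf|nLf] := pselect (mspan (lmons gt S) (LM gt f)).
  have [q [Aq q0 qf]] := span_product gtmo (subalg1 Aalg) (subalgM Aalg) SA Lf.
  have [r Ar rP] := step q q0 qf; exists r => [|b /rP [Lb /(mo_trans gtmo mf)]//].
  rewrite -[f](subrK ((LC gt f / LC gt q) *: q)) addrAC.
  by apply: (subalgD Aalg) => //; exact: subalgZ.
have [||r Ar rP] := step 'X_[LM gt f].
- by rewrite -msupp_eq0 msuppX.
- by apply: LM_unique => // [|b]; rewrite msuppX inE // => ->.
exists (LC gt f / LC gt 'X_[K, LM gt f] *: 'X_[LM gt f] + r); first by rewrite opprD addrA.
move=> b /msuppD_le; rewrite mem_cat => /orP [/msuppZ_le /mem_msuppXP <-|/rP [Lb]].
  by split.
by split=> //; exact: mo_trans mf _.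
Qed.

(** Suppose that [f] in [A] had a leading monomial [m] for [gt] outside the common
    span. Reducing the lower terms of [f] for [gt] gives an element of [A] whose
    terms are all outside the span, and which is nonzero because its term at [m] is
    untouched. Its leading monomial for [gt'] contradicts the assumption on [gt']. *)
Lemma sagbi_transfer gt' : monomial_ordering gt' ->
  (forall g, S g -> g != 0 -> LM gt g = LM gt' g) ->
  sagbi_basis gt' A S -> sagbi_basis gt A S.
Proof.
move=> gt'mo LMS /sagbiP [_ Sgt']; apply/sagbiP; split=> // f Af f0.
have lmE : lmons gt' S = lmons gt S.
  by apply/seteqP; split=> _ [g [Sg g0] <-]; exists g => //; rewrite LMS.
apply: contrapT => nLf; set m := LM gt f in nLf.
have [|r Ar rP] := @normal_form m (f - LC gt f *: 'X_[m]).
  move=> b bs; have bm : b != m.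
    apply: contraTneq bs => ->.
    by rewrite mcoeff_msupp mcoeffB mcoeffZ mcoeffX eqxx mulr1 subrr eqxx.
  move/msuppB_le: bs; rewrite mem_cat => /orP [fb|]; first exact: LM_gt.
  by move/msuppZ_le/mem_msuppXP => mb; rewrite mb eqxx in bm.
pose h := LC gt f *: 'X_[m] + r.
have Ah : A h.
  have -> : h = f - (f - LC gt f *: 'X_[m] - r).
    by rewrite -addrA opprD addrA subrr add0r opprD !opprK.
  exact: subalgB.
have hm : h@_m != 0.
  rewrite mcoeffD mcoeffZ mcoeffX eqxx mulr1 memN_msupp_eq0 ?addr0 ?LC_neq0 //.
  by apply/negP => /rP [_]; rewrite mo_irr.
have h0 : h != 0 by apply: contraNneq hm => ->; rewrite mcoeff0.
have := Sgt' h Ah h0; rewrite lmE.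
have /msuppD_le := LM_supp gt'mo h0.
by rewrite mem_cat => /orP [/msuppZ_le/mem_msuppXP <-|/rP []].
Qed.

End Transfer.

Lemma sagbi_span gt A S S' : subalgebra A -> S' `<=` A ->
  lmons gt S `<=` mspan (lmons gt S') -> sagbi_basis gt A S -> sagbi_basis gt A S'.
Proof.
move=> Aalg S'A SS' /sagbiP [_ Sgt]; apply/sagbiP; split=> // f Af f0.
exact: mspan_sub SS' _ (Sgt f Af f0).
Qed.

Section Subduction.
Variables (gt : rel 'X_{1..n}) (A : set poly).
Hypotheses (gtglobal : global_ordering gt) (Aalg : subalgebra A).
Let gtmo : monomial_ordering gt := gtglobal.1.
Implicit Types G H : {fset poly}.

Lemma lmons_fsetD1 G f : lmons gt [set` G] `<=`
  [set LM gt f] `|` lmons gt [set` (G `\ f)%fset].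
Proof.
move=> _ [g [/= Gg g0] <-]; have [->|gf] := eqVneq g f; first by left.
by right; exists g => //; split=> //=; rewrite in_fsetD1 gf.
Qed.

Lemma product_neq0 G (e : poly -> nat) : 0 \notin G -> \prod_(g <- G) g ^+ e g != 0.
Proof.
move=> G0; rewrite prodf_seq_neq0; apply/allP => g Gg; apply/implyP => _.
by rewrite expf_neq0 //; apply: contraNneq G0 => <-.
Qed.

Lemma LM_product_span G (e : poly -> nat) : 0 \notin G ->
  mspan (lmons gt [set` G]) (LM gt (\prod_(g <- G) g ^+ e g)).
Proof.
move=> G0; rewrite big_seq.
suff : \prod_(g <- G | g \in G) g ^+ e g != 0 /\
    mspan (lmons gt [set` G]) (LM gt (\prod_(g <- G | g \in G) g ^+ e g)) by case.
elim/big_rec: _ => [|g p Gg [p0 Lp]].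
  by rewrite oner_neq0 LM1 //; split=> //; exact: mspan0.
have g0 : g != 0 by apply: contraNneq G0 => <-.
elim: (e g) => [|k [q0 Lq]]; first by rewrite expr0 mul1r.
rewrite exprS -mulrA mulf_neq0 // LMM //; split=> //.
by apply: mspanS => //; exists g.
Qed.

Lemma span_LM_product G m : 0 \notin G -> mspan (lmons gt [set` G]) m ->
  exists e : poly -> nat, LM gt (\prod_(g <- G) g ^+ e g) = m.
Proof.
move=> G0; elim=> [|_ b [g [/= Gg g0] <-] _ [e <-]].
  by exists (fun=> 0%N); rewrite big1 ?LM1 // => g _; rewrite expr0.
exists (fun h => ((h == g) + e h)%N).
under eq_bigr do rewrite exprD; rewrite big_split /= LMM ?product_neq0 //.
rewrite (bigD1_seq g) ?fset_uniq //= eqxx expr1 big1 ?mulr1 // => h /negbTE ->.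
by rewrite expr0.
Qed.

(** Zero is excluded because a power product with the factor 0 has no leading
    monomial to cancel with. *)
Definition sagbi_fset G := sagbi_basis gt A [set` G] /\ 0 \notin G.

(** If the cancelled term is the leading one, then [LM gt f] lies in the span of the
    other elements, and removing [f] is harmless. If it is a tail term, then
    [LM gt f] remains the leading monomial of the new element. *)
Lemma subduction_sagbi G G' : subduction_step gt G G' -> sagbi_fset G -> sagbi_fset G'.
Proof.
move=> [f [e]]; cbv zeta; set p := \prod_(g <- _) _; set r := f - _ *: p.
move=> -[Gf pf G'E] [Gsagbi G0].
have [GA _] := Gsagbi.
have H0 : 0 \notin (G `\ f)%fset by rewrite in_fsetD1 negb_and G0 orbT.
have p0 : p != 0 by exact: product_neq0.
have Ar : A r.
  apply: (subalgB Aalg); first exact: GA.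
  apply: (subalgZ Aalg); apply: (subalg_prod Aalg) => g; rewrite in_fsetD1 => /andP [_ Gg].
  by apply: (subalgX Aalg); exact: GA.
have HG' g : g \in (G `\ f)%fset -> g \in G' /\ g != 0.
  move=> Hg; have g0 : g != 0 by apply: contraNneq H0 => <-.
  by split; [rewrite G'E in_fsetD1 in_fset1U g0 Hg orbT|].
split; last by rewrite G'E in_fsetD1 eqxx.
apply: sagbi_span Gsagbi => //.
  move=> g /=; rewrite G'E in_fsetD1 in_fset1U => /andP [_ /predU1P [->|]].
    exact: (subalgZ Aalg).
  by rewrite in_fsetD1 => /andP [_ Gg]; exact: GA.
have HS : lmons gt [set` (G `\ f)%fset] `<=` mspan (lmons gt [set` G']).
  by move=> _ [g [/= /HG' [G'g g0] _] <-]; apply: mspan_mem; exists g.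
move=> m /(@lmons_fsetD1 _ f) [->|/HS //] {m}.
have [<-|pfne] := eqVneq (LM gt p) (LM gt f).
  exact: mspan_sub HS _ (LM_product_span _ H0).
have f0 : f != 0 by apply: contraNneq G0 => <-.
have fp : gt (LM gt f) (LM gt p) by apply: LM_gt.
have coefr : r@_(LM gt f) = LC gt f.
  rewrite mcoeffB mcoeffZ [p@__]memN_msupp_eq0 ?mulr0 ?subr0 //.
  apply/negP => /(LM_gt gtmo); rewrite eq_sym pfne => /(_ isT) /(mo_trans gtmo fp).
  by rewrite mo_irr.
have rf : LM gt r = LM gt f.
  apply: LM_unique => // [|b /(cancel_LM gtmo p0) [_ [fb|pb] bf]].
  - by rewrite mcoeff_msupp coefr LC_neq0.
  - exact: LM_gt.
  - exact: mo_trans pb.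
have r0 : r != 0 by apply: contra_neq (LC_neq0 gtmo f0) => r0; rewrite -coefr r0 mcoeff0.
have c0 : (LC gt r)^-1 != 0 by rewrite invr_neq0 ?LC_neq0.
rewrite -rf -(LMZ gtmo r c0); apply: mspan_mem; exists ((LC gt r)^-1 *: r) => //.
by rewrite /= scaler_eq0 negb_or c0 r0 G'E in_fsetD1 in_fset1U eqxx scaler_eq0 negb_or c0 r0.
Qed.

Local Notation reduces := (clos_refl_trans _ (@subduction_step n K gt)).

Lemma reduces_sagbi G G' : reduces G G' -> sagbi_fset G -> sagbi_fset G'.
Proof.
by elim=> [H H' HH'|//|H H1 H2 _ IH1 _ IH2 /IH1 /IH2 //]; exact: subduction_sagbi.
Qed.

(** The leading monomial of [f] is that of a power product of elements of [H], as
    [H] is a Sagbi basis, so a subduction step can cancel the leading term of [f]. *)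
Lemma subduct_element H f : sagbi_fset H -> A f -> f != 0 -> f \notin H ->
  exists r, [/\ A r, forall b, b \in msupp r -> gt (LM gt f) b
    & subduction_step gt (f |` H)%fset ((r |` H) `\ 0)%fset].
Proof.
move=> [Hsagbi H0] Af f0 Hf.
have /sagbiP [HA /(_ f Af f0)] := Hsagbi => /(span_LM_product H0) [e pf].
have Ap : A (\prod_(g <- H) g ^+ e g).
  by apply: (subalg_prod Aalg) => g Hg; apply: (subalgX Aalg); exact: HA.
have p0 := product_neq0 e H0.
have stepP G D : (G `\ f)%fset = D -> f \in G -> let p := \prod_(g <- D) g ^+ e g in
    LM gt p \in msupp f -> let r := f - (f@_(LM gt p) / LC gt p) *: p in
    subduction_step gt G (((LC gt r)^-1 *: r |` D) `\ 0)%fset.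
  by move=> <- Gf p pm r; exists f, e.
have := stepP _ _ (fsetU1K Hf) (fset1U1 _ _); cbv zeta; rewrite pf => /(_ (LM_supp gtmo f0)).
set r := f - _ => step; exists ((LC gt r)^-1 *: r); split=> // [|b /msuppZ_le].
  by apply: (subalgZ Aalg); apply: (subalgB Aalg) => //; exact: (subalgZ Aalg).
by rewrite /r -{1}pf => /(cancel_LM gtmo p0); rewrite pf => -[bf [fb|//]]; exact: LM_gt.
Qed.

(** The leading monomials of the successive remainders decrease. The element also
    disappears when a remainder happens to be 0 or an element of [H], since the
    current set is then [H]. *)
Lemma subduct_to_zero H f : sagbi_fset H -> A f -> f != 0 -> f \notin H ->
  reduces (f |` H)%fset H.
Proof.
move=> Hs; elim/(lead_ind gtglobal): f => [|f f0 IH Af _ Hf].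
  by rewrite eqxx.
have [r [Ar rlt step]] := subduct_element Hs Af f0 Hf.
apply: rt_trans (rt_step _ _ _ _ step) _.
have HD0 : (H `\ 0)%fset = H by apply: mem_fsetD1; case: Hs.
have [->|r0] := eqVneq r 0.
  by rewrite fsetU1K; [exact: rt_refl|case: Hs].
have [Hr|Hr] := boolP (r \in H).
  have -> : (r |` H)%fset = H by apply/fsetUidPr; rewrite fsub1set.
  by rewrite HD0; exact: rt_refl.
rewrite fsetDUl HD0 mem_fsetD1 ?in_fset1 1?eq_sym //.
exact: IH.
Qed.

(** An element whose leading monomial lies in the span of the others is removed by
    subducting it to zero; the rest is a smaller Sagbi basis. *)
Lemma interreduce_exists G : sagbi_fset G -> exists2 G', reduces G G' & interreduced gt G'.
Proof.
elim: {G}_.+1 {-2}G (ltnSn #|` G|%fset) => // k IH G; rewrite ltnS => Gk [Gsagbi G0].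
have [Gred|] := pselect (interreduced gt G); first by exists G => //; exact: rt_refl.
rewrite /interreduced G0 => nred.
have [f [Gf /gen_LMsetP Lf]] : exists f, f \in G /\
    gen_alg (LMset gt [set` (G `\ f)%fset]) 'X_[LM gt f].
  apply: contrapT => nof; apply: nred; split=> // f Gf Lf.
  by apply: nof; exists f.
have [GA _] := Gsagbi.
have Hsagbi : sagbi_fset (G `\ f)%fset.
  split; last by rewrite in_fsetD1 negb_and G0 orbT.
  apply: sagbi_span Gsagbi => // [g /=|m /(@lmons_fsetD1 _ f) [->//|]].
    by rewrite in_fsetD1 => /andP [_]; exact: GA.
  exact: mspan_mem.
have [|G' GG' G'red] := IH (G `\ f)%fset _ Hsagbi.
  by move: Gk; rewrite (cardfsD1 f G) Gf.
exists G' => //; apply: rt_trans GG'; rewrite -{1}(fsetD1K Gf).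
apply: subduct_to_zero => //; [exact: GA|by apply: contraNneq G0 => <-|].
by rewrite in_fsetD1 eqxx.
Qed.

(** The leading monomials of an interreduced Sagbi basis are the irreducible
    elements of the monoid of all leading monomials of [A], and irreducible elements
    belong to every generating set. *)
Lemma interreduced_lmons G T : sagbi_fset G -> interreduced gt G -> sagbi_basis gt A T ->
  lmons gt [set` G] `<=` lmons gt T.
Proof.
move=> [/sagbiP [GA Gsagbi] G0] [_ Gred] /sagbiP [TA Tsagbi] _ [f [/= Gf f0] <-].
set a := LM gt f; set L := lmons gt [set` (G `\ f)%fset].
have naL : ~ mspan L a by move=> /gen_LMsetP; exact: Gred.
(* Being irreducible is used in this form: a sum is [a] plus something as soon as
   one of its summands is the leading monomial of [f]. *)
have spanG m : mspan (lmons gt [set` G]) m -> mspan L m \/ exists c, m = (a + c)%MM.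
  elim=> [|b c Gb _ IH]; first by left; exact: mspan0.
  have [->|Lb] := @lmons_fsetD1 G f _ Gb; first by right; exists c.
  case: IH => [Lc|[d ->]]; first by left; exact: mspanS.
  by right; exists (b + d)%MM; rewrite addmA [(b + a)%MM]addmC addmA.
have spanT m : mspan (lmons gt T) m -> mspan L m \/
    exists t c d, [/\ lmons gt T t, t = (a + c)%MM & m = (t + d)%MM].
  elim=> [|b c Tb _ IH]; first by left; exact: mspan0.
  have [Lb|[d bE]] : mspan L b \/ exists d, b = (a + d)%MM.
    by case: Tb => t [Tt t0] <-; apply/spanG/Gsagbi => //; exact: TA.
  - case: IH => [Lc|[t [c' [d [Tt tE ->]]]]]; first by left; exact: mspanD.
    by right; exists t, c', (b + d)%MM; split; rewrite // addmA [(b + t)%MM]addmC addmA.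
  - by right; exists b, d, c.
case: (spanT a) => // [|[t [c [d [Tt tE aE]]]]].
  by apply: Tsagbi => //; exact: GA.
have /eqP : (c + d)%MM = 0%MM by apply: (@addmI _ a); rewrite addm0 addmA -tE -aE.
by rewrite mnmD_eq0 => /andP [/eqP c0 _]; rewrite tE c0 addm0 in Tt.
Qed.

End Subduction.
End SagbiTheory.

(** * Initial forms and lifting *)

Lemma mcoeff_filter n (K : fieldType) (Q : pred 'X_{1..n}) (f : {mpoly K[n]}) a :
  (\sum_(b <- msupp f | Q b) f@_b *: 'X_[b])@_a = if Q a then f@_a else 0.
Proof.
rewrite linear_sum /= big_mkcond /=.
have [fa|fa] := boolP (a \in msupp f).
  rewrite (bigD1_seq a) ?msupp_uniq //= big1 => [|b /negbTE ba].
    by rewrite addr0 mcoeffZ mcoeffX eqxx mulr1.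
  by rewrite mcoeffZ mcoeffX ba mulr0 if_same.
rewrite (memN_msupp_eq0 fa) if_same big_seq big1 // => b fb.
rewrite mcoeffZ mcoeffX; case: eqP => [ba|_]; last by rewrite mulr0 if_same.
by rewrite -ba fb in fa.
Qed.

Section Weights.
Variables (n : nat) (K : fieldType) (R : realType) (w : 'rV[R]_n).
Local Notation poly := {mpoly K[n]}.
Local Notation deg := (wdegm w).
Implicit Types (f g h p : poly) (a b : 'X_{1..n}) (d e : R).

Lemma wdegmE a : deg a = \sum_i w 0 i * (a i)%:R.
Proof. by rewrite /wdegm mxE; apply: eq_bigr => i _; rewrite mxE. Qed.

Lemma wdegm0 : deg 0%MM = 0.
Proof. by rewrite wdegmE big1 // => i _; rewrite mnm0E mulr0. Qed.

Lemma wdegmD a b : deg (a + b)%MM = deg a + deg b.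
Proof.
by rewrite !wdegmE -big_split; apply: eq_bigr => i _; rewrite mnmDE natrD mulrDr.
Qed.

Definition wle d f := forall a, a \in msupp f -> deg a <= d.
Definition wlt d f := forall a, a \in msupp f -> deg a < d.
Definition whomog d f := forall a, a \in msupp f -> deg a = d.

Lemma whomog_le d f : whomog d f -> wle d f.
Proof. by move=> fd a /fd ->. Qed.

Lemma wlt0 d : wlt d 0. Proof. by move=> a; rewrite -[0]mpolyC0 msupp0. Qed.

Lemma wltD d f g : wlt d f -> wlt d g -> wlt d (f + g).
Proof. by move=> fd gd a /msuppD_le; rewrite mem_cat => /orP [/fd|/gd]. Qed.

Lemma wltZ d (c : K) f : wlt d f -> wlt d (c *: f).
Proof. by move=> fd a /msuppZ_le /fd. Qed.

Lemma wltW d e f : d <= e -> wlt d f -> wlt e f.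
Proof. by move=> de fd a /fd /lt_le_trans; apply. Qed.

Lemma whomogD d f g : whomog d f -> whomog d g -> whomog d (f + g).
Proof. by move=> fd gd a /msuppD_le; rewrite mem_cat => /orP [/fd|/gd]. Qed.

Lemma whomogZ d (c : K) f : whomog d f -> whomog d (c *: f).
Proof. by move=> fd a /msuppZ_le /fd. Qed.

Lemma whomog1 : whomog 0 1.
Proof. by move=> a; rewrite msupp1 inE => /eqP ->; rewrite wdegm0. Qed.

Lemma whomogM d e f g : whomog d f -> whomog e g -> whomog (d + e) (f * g).
Proof.
by move=> fd ge a /msuppM_le/allpairsP => -[[b c] /= [/fd <- /ge <- ->]]; rewrite wdegmD.
Qed.

Lemma wleM d e f g : wle d f -> wle e g -> wle (d + e) (f * g).
Proof.
move=> fd ge a /msuppM_le/allpairsP => -[[b c] /= [/fd bd /ge ce ->]].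
by rewrite wdegmD lerD.
Qed.

Lemma wltM d e f g : wlt d f -> wle e g -> wlt (d + e) (f * g).
Proof.
move=> fd ge a /msuppM_le/allpairsP => -[[b c] /= [/fd bd /ge ce ->]].
by rewrite wdegmD ltr_leD.
Qed.

Lemma mcoeff_Inw f a : (Inw w f)@_a = if deg a == wdeg w f then f@_a else 0.
Proof. exact: mcoeff_filter. Qed.

Lemma wle_wdeg f : wle (wdeg w f) f.
Proof. by move=> a fa; rewrite /wdeg; apply: le_bigmax_seq. Qed.

Lemma wdeg_attained f : f != 0 -> exists2 a, a \in msupp f & deg a = wdeg w f.
Proof.
move=> f0; rewrite /wdeg; apply: contrapT => no.
suff : forall s : seq 'X_{1..n}, {subset s <= msupp f} ->
  exists2 a, a \in msupp f & deg a = \big[Num.max/deg (mlead f)]_(a <- s) deg a.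
  by case/(_ (msupp f)) => // a fa aE; apply: no; exists a.
elim=> [_|b s IH bs]; first by exists (mlead f); rewrite ?mlead_supp ?big_nil.
rewrite big_cons; case: leP => _; last by exists b; rewrite ?bs ?mem_head.
by apply: IH => c cs; rewrite bs // inE cs orbT.
Qed.

Lemma Inw_homog f : whomog (wdeg w f) (Inw w f).
Proof.
by move=> a; rewrite mcoeff_msupp mcoeff_Inw; case: (deg a =P _) => // _; rewrite eqxx.
Qed.

Lemma Inw_lt f : wlt (wdeg w f) (f - Inw w f).
Proof.
move=> a; rewrite mcoeff_msupp mcoeffB mcoeff_Inw; case: (deg a =P _) => [_|/eqP ne].
  by rewrite subrr eqxx.
by rewrite subr0 -mcoeff_msupp lt_neqAle ne => /wle_wdeg.
Qed.

(** The hypotheses say that [h] is a homogeneous part of degree [d] and that the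
    rest of [f] is lower; the exponent [a] ensures that [f] does reach degree [d],
    so that [h] is not the zero part above the top. *)
Lemma Inw_unique d f h a : whomog d h -> wlt d (f - h) -> a \in msupp f -> d <= deg a ->
  wdeg w f = d /\ Inw w f = h.
Proof.
move=> hd fhd fa da.
have hf b : d <= deg b -> h@_b = f@_b.
  move=> db; apply/eqP; rewrite eq_sym -subr_eq0 -mcoeffB mcoeff_eq0.
  by apply/negP => /fhd; rewrite ltNge db.
have fle b : b \in msupp f -> deg b <= d.
  rewrite leNgt => fb; apply/negP => db; move: fb.
  by rewrite mcoeff_msupp -hf ?ltW // -mcoeff_msupp => /hd bd; rewrite bd ltxx in db.
have fd : wdeg w f = d.
  have f0 : f != 0 by apply: contraTneq fa => ->; rewrite -[0]mpolyC0 msupp0.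
  have [b /fle bd bE] := wdeg_attained f0; apply/le_anti.
  by rewrite -{1}bE bd (le_trans da) ?wle_wdeg.
split=> //; apply/mpolyP => b; rewrite mcoeff_Inw fd.
case: eqP => [bd|bd]; first by rewrite hf ?bd.
by apply/esym/memN_msupp_eq0/negP => /hd.
Qed.

Lemma Inw_unique_nz d f h : h != 0 -> whomog d h -> wlt d (f - h) ->
  wdeg w f = d /\ Inw w f = h.
Proof.
move=> h0 hd fhd; have [a ha] : exists a, a \in msupp h.
  by exists (mlead h); rewrite mlead_supp.
have da := hd _ ha; apply: (@Inw_unique _ _ _ a) => //; last by rewrite da.
apply: contraTT ha => fa; apply/negP => ha; have : a \in msupp (f - h).
  rewrite mcoeff_msupp mcoeffB (memN_msupp_eq0 fa) sub0r oppr_eq0.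
  by rewrite -mcoeff_msupp.
by move/fhd; rewrite da ltxx.
Qed.

Lemma Inw0 : Inw w (0 : poly) = 0.
Proof. by apply/mpolyP => a; rewrite mcoeff_Inw mcoeff0 if_same. Qed.

Lemma Inw_neq0 f : f != 0 -> Inw w f != 0.
Proof.
move=> /wdeg_attained [a fa ad]; apply: contraTneq fa => If0.
by have := mcoeff_Inw f a; rewrite ad eqxx If0 mcoeff0 mcoeff_msupp => <-; rewrite eqxx.
Qed.

Lemma Inw1 : Inw w (1 : poly) = 1.
Proof.
apply: (@Inw_unique_nz 0 1 1 _ whomog1 _).2; first exact: oner_neq0.
by rewrite subrr; exact: wlt0.
Qed.

Lemma InwM f g : Inw w (f * g) = Inw w f * Inw w g.
Proof.
have [->|f0] := eqVneq f 0; first by rewrite mul0r Inw0 mul0r.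
have [->|g0] := eqVneq g 0; first by rewrite mulr0 Inw0 mulr0.
apply: (@Inw_unique_nz (wdeg w f + wdeg w g) _ _ _ _ _).2.
- by rewrite mulf_neq0 ?Inw_neq0.
- by apply: whomogM; exact: Inw_homog.
have -> : f * g - Inw w f * Inw w g = (f - Inw w f) * g + (g - Inw w g) * Inw w f by ring.
apply: wltD; first exact: wltM (@Inw_lt f) (@wle_wdeg g).
by rewrite addrC; exact: wltM (@Inw_lt g) (whomog_le (@Inw_homog f)).
Qed.

Section Lifting.
Variables (k : nat) (G : k.-tuple poly).

Definition weight (a : 'X_{1..k}) : R := \sum_(i < k) wdeg w (tnth G i) *+ a i.

Definition initials : k.-tuple poly := map_tuple (Inw w) G.

Lemma initial_terms_homog (a : 'X_{1..k}) : whomog (weight a) ('X_[a] \mPo initials).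
Proof.
rewrite comp_mpolyX /weight; elim/big_rec2: _ => [|i p d _ pd]; first exact: whomog1.
apply: whomogM => //; rewrite tnth_map.
elim: (a i) => [|m IH]; first by rewrite expr0 mulr0n; exact: whomog1.
by rewrite exprS mulrS; apply: whomogM => //; exact: Inw_homog.
Qed.

(** Each generator is its initial form up to lower terms, and so is each power
    product, since degrees add. *)
Lemma lifted_terms_lt (a : 'X_{1..k}) :
  wlt (weight a) (('X_[a] \mPo G) - ('X_[a] \mPo initials)).
Proof.
rewrite !comp_mpolyX /weight.
have agM p q d p' q' d' :
    [/\ wle d p, whomog d q & wlt d (p - q)] ->
    [/\ wle d' p', whomog d' q' & wlt d' (p' - q')] ->
    [/\ wle (d + d') (p * p'), whomog (d + d') (q * q') & wlt (d + d') (p * p' - q * q')].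
  move=> [pd qd pqd] [pd' qd' pqd']; split; [exact: wleM|exact: whomogM|].
  have -> : p * p' - q * q' = (p - q) * p' + (p' - q') * q by ring.
  apply: wltD; first exact: wltM.
  by rewrite addrC; apply: wltM => //; exact: whomog_le.
have ag1 : [/\ wle 0 (1 : poly), whomog 0 (1 : poly) & wlt 0 (1 - 1 : poly)].
  by rewrite subrr; split; [exact/whomog_le/whomog1|exact: whomog1|exact: wlt0].
pose ag p q d := [/\ wle d p, whomog d q & wlt d (p - q)].
suff [] : ag (\prod_(i < k) tnth G i ^+ a i) (\prod_(i < k) tnth initials i ^+ a i)
   (\sum_(i < k) wdeg w (tnth G i) *+ a i) by [].
apply: (big_rec3 (fun d q p => ag p q d)) => [//|i d q p _ IH]; apply: (agM) => //.
rewrite tnth_map; elim: (a i) => [|m IHm]; first by rewrite !expr0 mulr0n.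
rewrite !exprS mulrS; apply: agM => //.
by split; [exact: wle_wdeg|exact: Inw_homog|exact: Inw_lt].
Qed.

Lemma comp_expand (P : {mpoly K[k]}) (T : k.-tuple poly) :
  P \mPo T = \sum_(a <- msupp P) P@_a *: ('X_[a] \mPo T).
Proof.
by rewrite {1}[P]mpolyE linear_sum; apply: eq_bigr => a _; rewrite linearZ.
Qed.

Lemma comp_lifted_lt (P : {mpoly K[k]}) d :
  (forall a : 'X_{1..k}, a \in msupp P -> weight a <= d) ->
  wlt d ((P \mPo G) - (P \mPo initials)).
Proof.
move=> Pd; rewrite !comp_expand -sumrB big_seq.
elim/big_rec: _ => [|a p Pa pd]; first exact: wlt0.
rewrite -scalerBr; apply: wltD => //; apply/wltZ/(wltW (Pd _ Pa)).
exact: lifted_terms_lt.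
Qed.

Lemma comp_initials_supp (P : {mpoly K[k]}) b : b \in msupp (P \mPo initials) ->
  exists2 a : 'X_{1..k}, a \in msupp P & deg b = weight a.
Proof.
rewrite comp_expand big_seq; elim/big_rec: _ => [|a p Pa IH].
  by rewrite -[0]mpolyC0 msupp0.
move/msuppD_le; rewrite mem_cat => /orP [/msuppZ_le /initial_terms_homog|/IH //].
by exists a.
Qed.

(** Substituting initial forms turns each monomial of [P] into a homogeneous
    polynomial of degree its weight. The monomials of weight above [d] contribute
    only to degrees above [d], where the result vanishes, so their contributions
    cancel. *)
Lemma truncate_weight (P : {mpoly K[k]}) d : wle d (P \mPo initials) ->
  exists2 P' : {mpoly K[k]}, P \mPo initials = P' \mPo initials &
    forall a : 'X_{1..k}, a \in msupp P' -> weight a <= d.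
Proof.
move=> Pd; pose P' := \sum_(a <- msupp P | weight a <= d) P@_a *: 'X_[a].
have P'd (a : 'X_{1..k}) : a \in msupp P' -> weight a <= d.
  by rewrite mcoeff_msupp mcoeff_filter; case: ifP => //; rewrite eqxx.
have P''d (a : 'X_{1..k}) : a \in msupp (P - P') -> d < weight a.
  rewrite mcoeff_msupp mcoeffB mcoeff_filter ltNge; case: ifP => //.
  by rewrite subrr eqxx.
exists P' => //; apply/eqP; rewrite -subr_eq0 -comp_mpolyB; apply/eqP/mpolyP => b.
rewrite mcoeff0; apply/memN_msupp_eq0/negP => bs.
have [a /P''d da ba] := comp_initials_supp bs.
move: bs; rewrite comp_mpolyB => /msuppB_le; rewrite mem_cat => /orP [/Pd|].
  by rewrite ba leNgt da.
by move/comp_initials_supp => [c /P'd cd bc]; move: cd; rewrite -bc ba leNgt da.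
Qed.

Lemma Inw_lift (P : {mpoly K[k]}) h : h != 0 -> h = P \mPo initials ->
  (forall a : 'X_{1..k}, a \in msupp P -> weight a <= wdeg w h) ->
  wdeg w (P \mPo G) = wdeg w h /\ Inw w (P \mPo G) = Inw w h.
Proof.
move=> h0 hE Pd; apply: Inw_unique_nz; [exact: Inw_neq0|exact: Inw_homog|].
rewrite -[P \mPo G](subrK h) -addrA; apply: wltD; last exact: Inw_lt.
by rewrite {2}hE; exact: comp_lifted_lt.
Qed.

End Lifting.

Lemma comp_subalg A k (G : k.-tuple poly) (P : {mpoly K[k]}) :
  subalgebra A -> (forall i, A (tnth G i)) -> A (P \mPo G).
Proof.
move=> Aalg GA; rewrite comp_expand; apply: (subalg_sum Aalg) => a _.
apply: (subalgZ Aalg); rewrite comp_mpolyX; apply: (subalg_prod Aalg) => i _.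
exact: (subalgX Aalg).
Qed.

Lemma gen_alg_comp k (G : k.-tuple poly) h :
  gen_alg [set` (G : seq poly)] h -> exists P : {mpoly K[k]}, h = P \mPo G.
Proof.
pose B := [set h | exists P : {mpoly K[k]}, h = P \mPo G].
suff /(_ h) : gen_alg [set` (G : seq poly)] `<=` B by [].
apply: gen_alg_min => [|g /= /tnthP [i ->]].
  apply/subalgebraP; split=> [|c f g [P ->] [Q ->]|f g [P ->] [Q ->]].
  - by exists 1; rewrite comp_mpoly1.
  - by exists (c *: P + Q); rewrite linearP.
  - by exists (P * Q); rewrite rmorphM.
by exists 'X_i; rewrite comp_mpolyXU -tnth_nth.
Qed.

Section Refinement.
Variable gt : rel 'X_{1..n}.

Definition refines := forall a b, deg b < deg a -> gt a b.

Hypotheses (gtmo : monomial_ordering gt) (gtw : refines).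

Lemma refines_le a b : gt a b -> deg b <= deg a.
Proof. by move=> ab; rewrite leNgt; apply/negP => /gtw; rewrite mo_asym. Qed.

Lemma wdeg_LM f : f != 0 -> wdeg w f = deg (LM gt f).
Proof.
move=> f0; apply/le_anti; rewrite wle_wdeg ?LM_supp // andbT.
have [a fa <-] := wdeg_attained f0.
by have [->//|/(LM_gt gtmo fa) /refines_le] := eqVneq a (LM gt f).
Qed.

Lemma LM_Inw f : LM gt (Inw w f) = LM gt f.
Proof.
have [->|f0] := eqVneq f 0; first by rewrite Inw0.
have sub a : a \in msupp (Inw w f) -> a \in msupp f.
  by rewrite !mcoeff_msupp mcoeff_Inw; case: ifP => //; rewrite eqxx.
apply: LM_unique => // [|b /sub]; last exact: LM_gt.
by rewrite mcoeff_msupp mcoeff_Inw wdeg_LM // eqxx LC_neq0.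
Qed.

End Refinement.

Lemma Inw_gen (gt : rel 'X_{1..n}) A S : global_ordering gt -> refines gt ->
  subalgebra A -> sagbi_basis gt A S ->
  forall f, A f -> gen_alg (Inw w @` S) (Inw w f).
Proof.
move=> gtglobal gtw Aalg /sagbiP [SA Sgt].
have gtmo := gtglobal.1; set B := gen_alg _.
have Balg : subalgebra B by exact: gen_alg_subalg.
elim/(lead_ind gtglobal) => [_|f f0 IH Af]; first by rewrite Inw0; exact: (subalg0 Balg).
have [||g Sg|p [[Ap Bp] p0 pf]] :=
    span_product (Q := fun p => A p /\ B (Inw w p)) gtmo _ _ _ (Sgt f Af f0).
- by rewrite Inw1; split; [exact: (subalg1 Aalg)|exact: (subalg1 Balg)].
- by move=> p q [Ap Bp] [Aq Bq]; rewrite InwM; split; [exact: (subalgM Aalg)|exact: (subalgM Balg)].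
- by split; [exact: SA|apply: sub_gen_alg; exists g].
(* Both [f] and [p] have weighted degree [d]. *)
set d := deg (LM gt f); have pd : wdeg w p = d by rewrite (wdeg_LM gtmo gtw) // pf.
set c := f@_(LM gt p) / LC gt p; pose r := f - c *: p.
have rlt b : b \in msupp r -> gt (LM gt f) b.
  case/(cancel_LM gtmo p0); rewrite pf => bf [fb|//]; exact: LM_gt.
have rB : B (Inw w r).
  by apply: IH => //; apply: (subalgB Aalg) => //; exact: (subalgZ Aalg).
(* The part of the remainder in degree [d]: its initial form, or 0 if it is lower. *)
have [h [Bh hd rh]] : exists h, [/\ B h, whomog d h & wlt d (r - h)].
  have [rd|rd] := pselect (wlt d r).
    exists 0; rewrite subr0; split=> //; first exact: (subalg0 Balg).
    by move=> a; rewrite -[0]mpolyC0 msupp0.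
  exists (Inw w r); have [a ra da] : exists2 a, a \in msupp r & d <= deg a.
    apply: contrapT => no; apply: rd => a ra; rewrite ltNge; apply/negP => da.
    by apply: no; exists a.
  have rd' : wdeg w r = d.
    have r0 : r != 0 by apply: contraTneq ra => ->; rewrite -[0]mpolyC0 msupp0.
    apply/le_anti; rewrite (le_trans da (wle_wdeg ra)) andbT.
    by have [b rb <-] := wdeg_attained r0; apply: (refines_le gtmo gtw); exact: rlt.
  by rewrite -rd'; split=> //; [exact: Inw_homog|exact: Inw_lt].
have -> : Inw w f = h + c *: Inw w p.
  apply: (@Inw_unique d _ _ (LM gt f) _ _ _ _).2 => //; last exact: LM_supp.
    by apply: whomogD => //; apply: whomogZ; rewrite -pd; exact: Inw_homog.
  have -> : f - (h + c *: Inw w p) = (r - h) + c *: (p - Inw w p).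
    by rewrite scalerBr /r; ring.
  by apply: wltD => //; apply: wltZ; rewrite -pd; exact: Inw_lt.
by apply: (subalgD Balg) => //; exact: (subalgZ Balg).
Qed.

End Weights.

(** * One pass through the loop body *)

Section OneCone.
Variables (n : nat) (K : fieldType) (R : realType) (w : 'rV[R]_n).
Local Notation poly := {mpoly K[n]}.
Variables (A : set poly) (gt gt0 : rel 'X_{1..n}).
Hypotheses (Aalg : subalgebra A) (gtglobal : global_ordering gt) (gtw : refines w gt).
Hypotheses (gt0global : global_ordering gt0) (gt0w : refines w gt0).
Variable S : {fset poly}.
Hypothesis Sagbi0 : sagbi_basis gt0 A [set` S].
Let gtmo : monomial_ordering gt := gtglobal.1.
Implicit Types (f g h p : poly) (T InS : {fset poly}).

Local Notation In := [fset Inw w f | f in S]%fset.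

Lemma initial_form_mem f : A f -> gen_alg [set` In] (Inw w f).
Proof.
suff -> : [set` In] = Inw w @` [set` S] by apply: (Inw_gen gt0global).
apply/seteqP; split=> [_ /= /imfsetP [g /= Sg ->]|_ [g /= Sg <-]]; first by exists g.
exact: in_imfset.
Qed.

Lemma lift_exists h : gen_alg [set` In] h -> exists hbar, lift_of w S h hbar.
Proof.
have -> : [set` In] = [set` (initials w (in_tuple S) : seq poly)].
  apply/seteqP; split=> [_ /= /imfsetP [g /= Sg ->]|_ /= /mapP [g Sg ->]].
    by apply/mapP; exists g.
  exact: in_imfset.
move=> /gen_alg_comp [P hE].
have [|P' PP' P'h] := @truncate_weight _ _ _ w _ (in_tuple S) P (wdeg w h).
  by rewrite -hE; exact: wle_wdeg.
by exists (P' \mPo in_tuple S), P'; split; rewrite // hE.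
Qed.

(** The initial form of a lift is that of the lifted polynomial, and a refining
    ordering sees the leading monomial in the initial form. *)
Lemma liftP h hbar : h != 0 -> lift_of w S h hbar ->
  [/\ A hbar, hbar != 0 & LM gt hbar = LM gt h].
Proof.
move=> h0 [P [hE Ph ->]]; have [SA _] := Sagbi0.
have [_ IE] := Inw_lift h0 hE Ph; split.
- by apply: comp_subalg => // i; apply: SA; rewrite /= mem_tnth.
- by apply: contra_neq (Inw_neq0 w h0) => P0; rewrite -IE P0 Inw0.
- by rewrite -(LM_Inw gtmo gtw) IE LM_Inw.
Qed.

Lemma monic_neq0 (G : set poly) : monic_set gt G -> forall h, G h -> h != 0.
Proof.
move=> Gmonic h /Gmonic LC1; apply: contra_eq_neq LC1 => ->.
by rewrite /LC mcoeff0 eq_sym oner_neq0.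
Qed.

(** For [f] in [A] the leading monomial of [f] is that of its initial form, which
    lies in the algebra of which [InS] is a Sagbi basis; lifting keeps the leading
    monomials of [InS]. *)
Lemma lifted_sagbi InS S1 : SagbiBasis In gt InS -> Lift InS S w S1 -> sagbi_fset gt A S1.
Proof.
move=> [/sagbiP [InSgen InSgt] /monic_neq0 InS0] [l [lP ->]].
have llP h : h \in InS -> [/\ A (l h), l h != 0 & LM gt (l h) = LM gt h].
  by move=> hIn; apply: liftP; [exact: InS0|exact: lP].
split; last first.
  by apply/imfsetP => -[h /= /llP [_ + _] l0]; rewrite -l0 eqxx.
apply/sagbiP; split=> [_ /= /imfsetP [h /= /llP [Al _ _] ->] //|f Af f0].
have := InSgt _ (initial_form_mem Af) (Inw_neq0 w f0); rewrite LM_Inw //.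
apply: mspan_sub => _ [h [/= hIn h0] <-]; have [_ l0 <-] := llP h hIn.
by apply: mspan_mem; exists (l h) => //; split=> //=; exact: in_imfset.
Qed.

(** The initial forms of a finite Sagbi basis [T] of [A], made monic, work: a
    nonzero element of the algebra of initial forms lifts to an element of [A] with
    the same leading monomial, which is a sum of leading monomials of [T]. *)
Lemma initial_sagbi_exists T : sagbi_basis gt A [set` T] ->
  exists InS, SagbiBasis In gt InS.
Proof.
move=> /sagbiP [TA Tgt]; pose nrm (t : poly) := (LC gt (Inw w t))^-1 *: Inw w t.
have ngen := gen_alg_subalg [set` In].
exists [fset nrm t | t in (T `\ 0)%fset]%fset; split; last first.
  move=> _ /= /imfsetP [t /= + ->]; rewrite in_fsetD1 => /andP [t0 _].
  by rewrite LCZ // mulVf // LC_neq0 // Inw_neq0.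
apply/sagbiP; split=> [_ /= /imfsetP [t /= + ->]|p Ip p0].
  by rewrite in_fsetD1 => /andP [_ Tt]; apply: (subalgZ ngen); apply: initial_form_mem; exact: TA.
have [pbar /(liftP p0) [Ap pbar0 <-]] := lift_exists Ip.
apply: mspan_sub (Tgt _ Ap pbar0) => _ [t [/= Tt t0] <-].
have c0 : (LC gt (Inw w t))^-1 != 0 by rewrite invr_neq0 // LC_neq0 // Inw_neq0.
apply: mspan_mem; exists (nrm t); last by rewrite LMZ // LM_Inw.
split; last by rewrite /nrm scaler_eq0 negb_or c0 Inw_neq0.
by apply: in_imfset; rewrite in_fsetD1 t0.
Qed.

Lemma lift_set_exists InS : SagbiBasis In gt InS -> exists S1, Lift InS S w S1.
Proof.
move=> [[InSgen _] _]; have /choice [l lP] : forall h, exists hbar, h \in InS -> lift_of w S h hbar.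
  move=> h; have [hIn|hIn] := boolP (h \in InS); last by exists 0.
  by have [hbar hP] := lift_exists (InSgen _ hIn); exists hbar.
by exists [fset l h | h in InS]%fset, l.
Qed.

End OneCone.

Section LoopBody.
Variables (n : nat) (K : fieldType) (R : realType) (w : 'rV[R]_n.+1) (Mt : 'M[R]_n.+1).
Local Notation poly := {mpoly K[n.+1]}.
Variables (A : set poly) (gt0 : rel 'X_{1..n.+1}) (S : {fset poly}).
Local Notation gt := (wgt w Mt).
Hypotheses (Aalg : subalgebra A) (gtglobal : global_ordering gt) (gtw : refines w gt).
Hypotheses (gt0global : global_ordering gt0) (gt0w : refines w gt0).
Hypothesis Sagbi0 : sagbi_basis gt0 A [set` S].

Lemma interreduce_sagbi (G G' : {fset poly}) : Interreduce gt G G' -> sagbi_fset gt A G ->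
  sagbi_fset gt A G' /\ interreduced gt G'.
Proof.
move=> [GG' G'red] Gs; split=> //; apply: (reduces_sagbi gtglobal Aalg GG').
by rewrite mem_fsetD1 //; case: Gs.
Qed.

Lemma loop_body_sagbi S' : loop_body Mt S w S' ->
  sagbi_fset gt A S' /\ interreduced gt S'.
Proof.
move=> [InS [S1 [InSP S1P /interreduce_sagbi]]]; apply.
exact: (lifted_sagbi Aalg gtglobal gtw gt0global gt0w Sagbi0 InSP S1P).
Qed.

Lemma loop_body_exists (T : {fset poly}) : sagbi_basis gt A [set` T] ->
  exists S', loop_body Mt S w S'.
Proof.
move=> Tgt; have [InS InSP] :=
  initial_sagbi_exists Aalg gtglobal gtw gt0global gt0w Sagbi0 Tgt.
have [S1 S1P] := lift_set_exists InSP.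
have S1s := lifted_sagbi Aalg gtglobal gtw gt0global gt0w Sagbi0 InSP S1P.
have [S' S1S' S'red] := interreduce_exists gtglobal Aalg S1s.
by exists S', InS, S1; split=> //; split=> //; rewrite mem_fsetD1 //; case: S1s.
Qed.

End LoopBody.

(** * Refining an ordering by a weight *)

Section Refinement.
Variables (n : nat) (R : realType).
Implicit Types (w : 'rV[R]_n) (gt : rel 'X_{1..n}) (a b : 'X_{1..n}).

Definition refine w gt : rel 'X_{1..n} := fun a b =>
  (wdegm w b < wdegm w a) || ((wdegm w b == wdegm w a) && gt a b).

Lemma refine_refines w gt : refines w (refine w gt).
Proof. by move=> a b ab; rewrite /refine ab. Qed.

Lemma refine_mo w gt : monomial_ordering gt -> monomial_ordering (refine w gt).
Proof.
move=> gtmo; split=> [a|b a c|a b ab|a b c]; rewrite /refine.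
- by rewrite ltxx mo_irr // andbF.
- case/orP => [ba|/andP [/eqP -> gab]] /orP [cb|/andP [/eqP -> gbc]].
  + by rewrite (lt_trans cb ba).
  + by rewrite ba.
  + by rewrite cb.
  + by rewrite eqxx (mo_trans gtmo gab gbc) orbT.
- case: (ltgtP (wdegm w a) (wdegm w b)) => //= _; exact: mo_total.
- rewrite !wdegmD ltrD2r (inj_eq (addIr _)) => /orP [->//|/andP [-> /(mo_addr gtmo c) ->]].
  by rewrite orbT.
Qed.

(** A weight that is nonnegative on all monomials cannot place a monomial below 1. *)
Lemma refine_global w gt : global_ordering gt -> (forall a, 0 <= wdegm w a) ->
  global_ordering (refine w gt).
Proof.
move=> [gtmo gt0] w0; split=> [|a a0]; first exact: refine_mo.
by rewrite /refine wdegm0 gt0 // andbT orbC -le_eqVlt.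
Qed.

Lemma global_wdegm_ge0 w gt a : global_ordering gt -> refines w gt -> 0 <= wdegm w a.
Proof.
move=> [gtmo gt0] gtw; have [->|/gt0] := eqVneq a 0%MM; first by rewrite wdegm0.
by move/(refines_le gtmo gtw); rewrite wdegm0.
Qed.

Lemma mxgtP m (M : 'M[R]_(m, n)) a b :
  reflect (exists2 k : 'I_m, forall i : 'I_m, (i < k)%N ->
             (M *m expvec R b) i 0 = (M *m expvec R a) i 0
           & (M *m expvec R b) k 0 < (M *m expvec R a) k 0)
          (mxgt M a b).
Proof.
rewrite /mxgt; apply: (iffP ltxi_tuplePlt) => -[k kP]; rewrite ?tnth_mktuple => klt; exists k => //.
- by move=> i /kP; rewrite !tnth_mktuple.
- by move=> i /kP; rewrite !tnth_mktuple.
- by rewrite !tnth_mktuple.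
Qed.

Lemma wgtE w (M : 'M[R]_n) : wgt w M =2 refine w (mxgt M).
Proof.
move=> a b; rewrite /refine /wgt.
have up c (i : 'I_1) : (col_mx w M *m expvec R c) (lshift n i) 0 = wdegm w c.
  by rewrite mul_col_mx col_mxEu ord1.
have dn c i : (col_mx w M *m expvec R c) (rshift 1 i) 0 = (M *m expvec R c) i 0.
  by rewrite mul_col_mx col_mxEd.
apply/mxgtP/orP => [[k kP]|].
  case: (split_ordP k) kP => i ->{k} kP; first by rewrite !up; left.
  rewrite !dn => klt; right; rewrite -!(up _ 0) kP ?eqxx //=.
  by apply/mxgtP; exists i => // j ji; rewrite -!dn; apply: kP; rewrite /= ltn_add2l.
case=> [ab|/andP [/eqP abE /mxgtP [k kP klt]]].
  by exists (lshift n 0); rewrite ?up // => i; rewrite ltn0.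
exists (rshift 1 k); rewrite ?dn // => i.
by case: (split_ordP i) => j -> jk; rewrite ?up // !dn; apply: kP; rewrite /= ltn_add2l in jk.
Qed.

End Refinement.

Section FirstRow.
Variables (n : nat) (R : realType) (M : 'M[R]_n.+1).

Lemma wdegm_row0 a : wdegm (row 0 M) a = (M *m expvec R a) 0 0.
Proof. by rewrite /wdegm -row_mul mxE. Qed.

Lemma mxgt_refines_row0 : refines (row 0 M) (mxgt M).
Proof. by move=> a b; rewrite !wdegm_row0 => ab; apply/mxgtP; exists 0. Qed.

Lemma wgt_row0 : wgt (row 0 M) M = mxgt M.
Proof.
apply/funext => a; apply/funext => b; rewrite wgtE /refine.
have [ab|ba|//] /= := ltgtP (wdegm (row 0 M) b) (wdegm (row 0 M) a).
  by rewrite mxgt_refines_row0.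
apply/esym/negP => /mxgtP [k kP klt]; move: ba; rewrite !wdegm_row0.
have [k0|k0] := posnP k; last by rewrite kP ?ltxx.
have -> : 0 = k by apply: val_inj.
by rewrite (lt_gtF klt).
Qed.

End FirstRow.

(** * The step to the next cone *)

Section NextCone.
Variables (n : nat) (K : fieldType) (R : realType).
Implicit Types (w : 'rV[R]_n).

Lemma wdegm_lin w w' (c d : R) a :
  wdegm (c *: w + d *: w') a = c * wdegm w a + d * wdegm w' a.
Proof.
rewrite !wdegmE !mulr_sumr -big_split; apply: eq_bigr => i _ /=.
by rewrite !mxE mulrDl !mulrA.
Qed.

Definition wdiff w a b : R := wdegm w a - wdegm w b.

Lemma wdiffE w a b : (w *m (expvec R a - expvec R b)) 0 0 = wdiff w a b.
Proof. by rewrite mulmxBr mxE [X in _ + X]mxE. Qed.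

Lemma wdiff_lin w w' (c d : R) a b :
  wdiff (c *: w + d *: w') a b = c * wdiff w a b + d * wdiff w' a b.
Proof. by rewrite /wdiff !wdegm_lin; ring. Qed.

Section Fold.
Variables (T : eqType) (d dt : T -> R).

Let hit (u : R) v :=
  if dt v < 0 then let u' := d v / (d v - dt v) in if u' < u then u' else u else u.

Lemma fold_hit_le vs u : foldl hit u vs <= u.
Proof.
elim: vs u => [|v vs IH] u /=; first exact: lexx.
apply: le_trans (IH _) _; rewrite /hit; case: ifP => // _.
by case: ltP => // /ltW.
Qed.

Lemma fold_hit_min vs u v : v \in vs -> dt v < 0 -> foldl hit u vs <= d v / (d v - dt v).
Proof.
elim: vs u => [|x vs IH] u //=; rewrite inE => /predU1P [<-|vvs] dtv; last exact: IH.
apply: le_trans (fold_hit_le _ _) _; rewrite /hit dtv /=.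
by case: ltP.
Qed.

Lemma fold_hit_attained vs u : foldl hit u vs = u \/
  exists v, [/\ v \in vs, dt v < 0 & foldl hit u vs = d v / (d v - dt v)].
Proof.
elim: vs u => [|x vs IH] u /=; first by left.
have [->|[v [vvs dtv ->]]] := IH (hit u x); last first.
  by right; exists v; rewrite inE vvs orbT.
rewrite /hit; case: ifP => [dtx|]; last by left.
by case: ifP => _; [right; exists x; rewrite mem_head|left].
Qed.

End Fold.

Section Cone.
Variables (gt : rel 'X_{1..n}) (S : {fset {mpoly K[n]}}) (w wt : 'rV[R]_n).
Local Notation u := (NextCone gt S w wt).

Lemma cone_vectorsP v : v \in cone_vectors R gt S -> exists f b,
  [/\ f \in S, b \in msupp f, b != LM gt f & v = expvec R (LM gt f) - expvec R b].
Proof.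
move=> /allpairsPdep [f [b [Sf + ->]]]; rewrite mem_filter => /andP [bf fb].
by exists f, b.
Qed.

Lemma mem_cone_vectors f b : f \in S -> b \in msupp f -> b != LM gt f ->
  expvec R (LM gt f) - expvec R b \in cone_vectors R gt S.
Proof.
move=> Sf fb bf; apply/allpairsPdep; exists f, b; split=> //.
by rewrite mem_filter bf.
Qed.

Lemma NextCone_le1 : u <= 1.
Proof. exact: (fold_hit_le (fun v => (w *m v) 0 0) (fun v => (wt *m v) 0 0)). Qed.

Lemma NextCone_min f b : f \in S -> b \in msupp f -> b != LM gt f ->
  wdiff wt (LM gt f) b < 0 ->
  u <= wdiff w (LM gt f) b / (wdiff w (LM gt f) b - wdiff wt (LM gt f) b).
Proof.
move=> Sf fb bf; rewrite -!wdiffE => neg.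
exact: (fold_hit_min (fun v => (w *m v) 0 0) (dt := fun v => (wt *m v) 0 0)
  1 (mem_cone_vectors Sf fb bf)).
Qed.

Lemma NextCone_attained : u = 1 \/ exists f b,
  [/\ f \in S, b \in msupp f, b != LM gt f, wdiff wt (LM gt f) b < 0
    & u = wdiff w (LM gt f) b / (wdiff w (LM gt f) b - wdiff wt (LM gt f) b)].
Proof.
have : u = 1 \/ exists v, [/\ v \in cone_vectors R gt S, (wt *m v) 0 0 < 0
    & u = (w *m v) 0 0 / ((w *m v) 0 0 - (wt *m v) 0 0)].
  exact: (fold_hit_attained (fun v => (w *m v) 0 0) (fun v => (wt *m v) 0 0)).
case=> [->|[v [vS dtv ->]]]; first by left.
right; have [f [b [Sf fb bf vE]]] := cone_vectorsP vS.
by exists f, b; rewrite -!wdiffE -vE.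
Qed.

Hypothesis pos : forall f b, f \in S -> b \in msupp f -> b != LM gt f ->
  0 <= wdiff w (LM gt f) b /\ (wdiff wt (LM gt f) b < 0 -> 0 < wdiff w (LM gt f) b).

Lemma NextCone_gt0 : 0 < u.
Proof.
have [->|[f [b [Sf fb bf neg ->]]]] := NextCone_attained; first exact: ltr01.
have [_ /(_ neg) dpos] := pos Sf fb bf.
by rewrite divr_gt0 // subr_gt0 (lt_trans neg).
Qed.

(** The next weight is the last one for which no tail term outweighs its leading
    monomial: a difference that decreases towards [wt] reaches 0 at its own ratio,
    which is at least the minimum [u]. *)
Lemma NextCone_stays f b : f \in S -> b \in msupp f -> b != LM gt f ->
  0 <= wdiff ((1 - u) *: w + u *: wt) (LM gt f) b.
Proof.
move=> Sf fb bf; rewrite wdiff_lin; have [d0 dpos] := pos Sf fb bf.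
have u0 := ltW NextCone_gt0; have u1 : 0 <= 1 - u by rewrite subr_ge0 NextCone_le1.
have [dt0|neg] := leP 0 (wdiff wt (LM gt f) b); first by rewrite addr_ge0 ?mulr_ge0.
have := NextCone_min Sf fb bf neg; rewrite ler_pdivlMr.
  by set d := wdiff w _ _; set dt := wdiff wt _ _; lra.
by rewrite subr_gt0 (lt_trans neg) ?dpos.
Qed.

Lemma NextCone_wall : u = 1 \/ exists f b,
  [/\ f \in S, b \in msupp f, wdiff wt (LM gt f) b < 0, 0 < wdiff w (LM gt f) b
    & wdiff ((1 - u) *: w + u *: wt) (LM gt f) b = 0].
Proof.
have [->|[f [b [Sf fb bf neg uE]]]] := NextCone_attained; first by left.
right; exists f, b; have [_ /(_ neg) dpos] := pos Sf fb bf; split=> //.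
rewrite wdiff_lin uE; set d := wdiff w _ _ in dpos *; set dt := wdiff wt _ _ in neg *.
by field; rewrite subr_eq0 gt_eqF // (lt_trans neg).
Qed.

End Cone.
End NextCone.

(** * The loop invariant *)

Section Invariant.
Variables (R : realType) (K : fieldType) (n : nat).
Variables (A : set {mpoly K[n.+1]}) (Ms Mt : 'M[R]_n.+1).
Hypothesis Aalg : subalgebra A.
Hypothesis Afin : forall gt : rel 'X_{1..n.+1}, global_ordering gt ->
     exists S : {fset {mpoly K[n.+1]}}, sagbi_basis gt A [set` S].
Hypotheses (Msglobal : global_ordering (mxgt Ms)) (Mtglobal : global_ordering (mxgt Mt)).
Local Notation ws := (row 0 Ms).
Local Notation wt := (row 0 Mt).
Local Notation gtw w := (wgt w Mt).
Implicit Types (t : R) (S : {fset {mpoly K[n.+1]}}) (f : {mpoly K[n.+1]}).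

Definition segment t : 'rV[R]_n.+1 := (1 - t) *: ws + t *: wt.

Lemma ws_ge0 a : 0 <= wdegm ws a.
Proof. exact: global_wdegm_ge0 Msglobal (@mxgt_refines_row0 _ _ _). Qed.

Lemma wt_ge0 a : 0 <= wdegm wt a.
Proof. exact: global_wdegm_ge0 Mtglobal (@mxgt_refines_row0 _ _ _). Qed.

Lemma segment_ge0 t a : 0 <= t <= 1 -> 0 <= wdegm (segment t) a.
Proof.
by move=> /andP [t0 t1]; rewrite wdegm_lin addr_ge0 ?mulr_ge0 ?subr_ge0 ?ws_ge0 ?wt_ge0.
Qed.

Lemma wgt_refine w : gtw w = refine w (mxgt Mt).
Proof. by apply/funext => a; apply/funext => b; exact: wgtE. Qed.

Lemma wgt_refines w : refines w (gtw w).
Proof. by rewrite wgt_refine; exact: refine_refines. Qed.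

Lemma wgt_global t : 0 <= t <= 1 -> global_ordering (gtw (segment t)).
Proof.
by move=> t01; rewrite wgt_refine; apply: refine_global => // a; exact: segment_ge0.
Qed.

Lemma segment_next t u : (1 - u) *: segment t + u *: wt = segment (t + u * (1 - t)).
Proof. by apply/rowP => i; rewrite !mxE; ring. Qed.

(** The ordering [gt0] is left open because it changes with the state: it is the
    source ordering at first, and afterwards the current weight refined by the
    ordering of the previous pass. *)
Definition invariant S t := 0 <= t <= 1 /\ exists gt0 : rel 'X_{1..n.+1},
  [/\ global_ordering gt0, refines (segment t) gt0 & sagbi_basis gt0 A [set` S]].

Lemma body_sagbi S t S' : invariant S t -> loop_body Mt S (segment t) S' ->
  sagbi_fset (gtw (segment t)) A S' /\ interreduced (gtw (segment t)) S'.
Proof.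
move=> [t01 [gt0 [gt0g gt0w Sgt0]]].
exact: (loop_body_sagbi Aalg (wgt_global t01) (@wgt_refines _) gt0g gt0w Sgt0).
Qed.

(** On a tie for the weight the leading monomial wins by the ordering of [Mt], hence
    by the weight [wt]; so a term that [wt] prefers is strictly behind now. *)
Lemma leading_wdiff t f b : 0 <= t <= 1 ->
  b \in msupp f -> b != LM (gtw (segment t)) f ->
  0 <= wdiff (segment t) (LM (gtw (segment t)) f) b /\
  (wdiff wt (LM (gtw (segment t)) f) b < 0 ->
   0 < wdiff (segment t) (LM (gtw (segment t)) f) b).
Proof.
move=> t01 fb bf; rewrite /wdiff !subr_ge0 subr_lt0 subr_gt0.
have gtmo := (wgt_global t01).1.
have := LM_gt gtmo fb bf; rewrite {1}wgt_refine /refine.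
case/orP => [lt|/andP [/eqP -> gtt]]; first by rewrite ltW.
split=> //; have := refines_le Mtglobal.1 (@mxgt_refines_row0 _ _ Mt) gtt.
by rewrite leNgt => /negbTE ->.
Qed.

(** The new ordering compares by the new weight and breaks ties by the ordering used
    in this pass. No tail term has overtaken its leading monomial, so both orderings
    have the same leading monomials on the new basis. *)
Lemma invariant_next S t S' : invariant S t -> loop_body Mt S (segment t) S' ->
  invariant S' (t + NextCone (gtw (segment t)) S' (segment t) wt * (1 - t)).
Proof.
move=> Sinv body; have [t01 _] := Sinv; have /andP [t0 t1] := t01.
have pos f b (_ : f \in S') := @leading_wdiff t f b t01.
set u := NextCone _ _ _ _; set t' := t + _.
have u0 : 0 < u := NextCone_gt0 pos.
have u1 : u <= 1 := NextCone_le1 _ _ _ _.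
have t'01 : 0 <= t' <= 1 by rewrite /t'; apply/andP; split; nra.
have [[S'sagbi _] _] := body_sagbi Sinv body.
split=> //; exists (refine (segment t') (gtw (segment t))).
have gtg : global_ordering (gtw (segment t)) by exact: wgt_global.
have gt'g : global_ordering (refine (segment t') (gtw (segment t))).
  by apply: refine_global => // a; exact: segment_ge0.
split=> //; first exact: refine_refines.
apply: (sagbi_transfer gt'g Aalg _ gtg.1 _ S'sagbi); first by have [] := S'sagbi.
move=> f /= Sf f0; apply: (LM_unique gt'g.1); [exact: (LM_supp gtg.1 f0)|].
move=> b fb bf; have := NextCone_stays pos Sf fb bf.
rewrite -/u segment_next -/t' /wdiff subr_ge0 le_eqVlt /refine.
by case/orP => [->|->//]; rewrite LM_gt ?orbT //; exact: gtg.1.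
Qed.

Lemma progress S t : invariant S t -> exists st, step Mt (Running S (segment t)) st.
Proof.
move=> [t01 [gt0 [gt0g gt0w Sgt0]]]; have [T Tgt] := Afin (wgt_global t01).
have [S' body] := loop_body_exists Aalg (wgt_global t01) (@wgt_refines _) gt0g gt0w Sgt0 Tgt.
have [wE|wN] := pselect (segment t = wt).
  by exists (Returned R S'); exact: (StepDone body wE).
eexists; exact: (StepNext body wN).
Qed.

Definition good (st : state n K R) : Prop :=
  match st with
  | Running G w => exists2 t, w = segment t & invariant G t
  | Returned G => sagbi_basis (mxgt Mt) A [set` G]
  end.

Lemma step_good st st' : step Mt st st' -> good st -> good st'.
Proof.
case=> [G w G' body wE [t wtE Ginv]|G w G' body wN u [t wtE Ginv]] /=.
  rewrite wtE in body; have [[+ _] _] := body_sagbi Ginv body.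
  by rewrite -wtE wE wgt_row0.
rewrite /u {u wN}; subst w.
exists (t + NextCone (gtw (segment t)) G' (segment t) wt * (1 - t)).
  exact: segment_next.
exact: invariant_next Ginv body.
Qed.

Lemma reachable_good st st' : reachable Mt st st' -> good st -> good st'.
Proof. by elim=> [x y /step_good //|//|x y z _ IH1 _ IH2 /IH1 /IH2]. Qed.

End Invariant.

(** * Termination *)

Lemma nneg_comb_eq0 (R : realDomainType) (c d s q : R) :
  0 <= c -> 0 < d -> 0 <= s -> 0 <= q -> c * s + d * q = 0 -> q = 0.
Proof.
move=> c0 d0 s0 q0 /eqP; rewrite paddr_eq0 ?mulr_ge0 ?(ltW d0) // => /andP [_].
by rewrite mulf_eq0 (gt_eqF d0) => /eqP.
Qed.

Lemma not_Acc_step T (r : T -> T -> Prop) x : ~ Acc r x -> exists2 y, r y x & ~ Acc r y.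
Proof.
move=> xN; apply: contrapT => no; apply: xN; constructor => y yx.
by apply: contrapT => yN; apply: no; exists y.
Qed.

(** Induction on [W]: once the ascent has reached [x], it can never use [x] again;
    if it stays below [x], it never uses [x] at all. *)
Lemma no_finite_ascent (R : realType) (W : seq R) (E : R -> Prop) :
  (forall t, E t -> exists t', [/\ E t', t < t' & t' \in W]) -> forall t, ~ E t.
Proof.
elim: W E => [|x W IH] E asc t Et; first by have [t' []] := asc t Et.
have [[e [Ee xe]]|noge] := pselect (exists e, E e /\ x <= e).
  apply: (IH (fun s => E s /\ x <= s)) (conj Ee xe) => s [/asc [t' [Et' st']]].
  rewrite inE => /predU1P [t'x|Wt'] xs; first by move: st'; rewrite t'x ltNge xs.
  by exists t'; split=> //; split=> //; exact: le_trans (ltW st').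
apply: (IH E) Et => s /asc [t' [Et' st']]; rewrite inE => /predU1P [t'x|Wt'].
  by case: noge; exists t'; rewrite -t'x.
by exists t'.
Qed.

(** A coordinate of positive weight is bounded by the total weight divided by it. *)
Lemma bounded_exponents (R : realType) n (w : 'rV[R]_n) (C : R) :
  (forall i, 0 <= w 0 i) -> exists N, forall a : 'X_{1..n},
    (forall i, w 0 i = 0 -> a i = 0%N) -> wdegm w a <= C -> (mdeg a < N)%N.
Proof.
move=> w0; exists (\sum_i Num.bound (C / w 0 i)%R)%N.+1 => a a0 aC.
rewrite ltnS mdegE; apply: leq_sum => i _.
have [wi|wi] := eqVneq (w 0 i) 0; first by rewrite a0.
have wi0 : 0 < w 0 i by rewrite lt_neqAle eq_sym wi w0.
have aiC : (a i)%:R <= C / w 0 i.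
  rewrite ler_pdivlMr // mulrC; apply: le_trans aC.
  rewrite wdegmE (bigD1 i) //= lerDl; apply: sumr_ge0 => j _.
  by rewrite mulr_ge0 ?w0.
have := archi_boundP (le_trans (ler0n _ _) aiC) => /(le_lt_trans aiC).
by rewrite ltr_nat => /ltnW.
Qed.

Lemma uniform_radius (R : realType) (T : eqType) (s : seq T) (P : T -> R -> Prop) (x0 : R) :
  (forall p, exists2 e : R, 0 < e & forall t, x0 - e < t < x0 -> P p t) ->
  exists2 e : R, 0 < e & forall t, x0 - e < t < x0 -> forall p, p \in s -> P p t.
Proof.
move=> loc; elim: s => [|p s [e e0 IH]]; first by exists 1.
have [d d0 pP] := loc p; exists (Num.min d e); first by rewrite lt_min d0.
move=> t /andP [lt tx] q; rewrite inE => /predU1P [->|qs].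
  by apply: pP; rewrite tx andbT (le_lt_trans _ lt) // lerB // ge_min lexx.
by apply: IH => //; rewrite tx andbT (le_lt_trans _ lt) // lerB // ge_min lexx orbT.
Qed.

Section Termination.
Variables (R : realType) (K : fieldType) (n : nat).
Variables (A : set {mpoly K[n.+1]}) (Ms Mt : 'M[R]_n.+1).
Hypothesis Aalg : subalgebra A.
Hypothesis Afin : forall gt : rel 'X_{1..n.+1}, global_ordering gt ->
     exists S : {fset {mpoly K[n.+1]}}, sagbi_basis gt A [set` S].
Hypotheses (Msglobal : global_ordering (mxgt Ms)) (Mtglobal : global_ordering (mxgt Mt)).
Local Notation ws := (row 0 Ms).
Local Notation wt := (row 0 Mt).
Local Notation W := (segment Ms Mt).
Local Notation gtw t := (wgt (W t) Mt).
Implicit Types (t : R) (S : {fset {mpoly K[n.+1]}}).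

Definition nonterminating t := exists S,
  invariant A Ms Mt S t /\ ~ terminates Mt (Running S (W t)).

(** The parameter at which [a] and [b] have the same weight on the segment. *)
Definition wall (a b : 'X_{1..n.+1}) : R := wdiff ws a b / (wdiff ws a b - wdiff wt a b).

Lemma wdiff_segment t a b : wdiff (W t) a b = (1 - t) * wdiff ws a b + t * wdiff wt a b.
Proof. exact: wdiff_lin. Qed.

(** The parameter 1 is excluded since the run stops there, so the next parameter
    must come from a wall of the basis computed in this pass. *)
Lemma nonterminating_next t : nonterminating t -> exists t',
  [/\ nonterminating t', t < t' & t' < 1] /\
  exists S f b, [/\ sagbi_fset (gtw t) A S, interreduced (gtw t) S, f \in S &
    let a := LM (gtw t) f in
    [/\ wdiff wt a b < 0, 0 < wdiff (W t) a b & t' = wall a b]].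
Proof.
have lt1 t0 : nonterminating t0 -> t0 < 1.
  move=> [S [[/andP [_ t1] _] nacc]]; rewrite lt_neqAle t1 andbT.
  apply/eqP => t0E; apply: nacc; constructor => y st.
  have wE : W t0 = wt by rewrite t0E /segment subrr scale0r scale1r add0r.
  inversion st; subst; last by rewrite wE in H3.
  by constructor => z zst; inversion zst.
move=> tbad; have t1 := lt1 t tbad; have [S [Sinv nacc]] := tbad.
have [y st yN] := not_Acc_step nacc.
inversion st as [G w S' body wE|G w S' body wN u]; subst.
  by case: yN; constructor => z zst; inversion zst.
have [t01 _] := Sinv; have /andP [t0 _] := t01.
have pos f b (_ : f \in S') := @leading_wdiff _ K _ _ _ Msglobal Mtglobal t f b t01.
have S'inv := invariant_next Aalg Msglobal Mtglobal Sinv body.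
rewrite /u segment_next in yN; clear st u wN; set u' := NextCone _ _ _ _ in yN S'inv *.
set t' := t + u' * (1 - t) in yN S'inv.
have t'bad : nonterminating t' by exists S'.
have t't : t < t' by rewrite ltrDl mulr_gt0 ?subr_gt0 // /u'; exact: NextCone_gt0 pos.
exists t'; split; first by split=> //; exact: lt1.
have [S's S'red] := body_sagbi Aalg Msglobal Mtglobal Sinv body.
have [u1|[f [b [Sf fb neg dpos]]]] := NextCone_wall pos.
  by have := lt1 _ t'bad; rewrite /t' /u' u1 mul1r addrC subrK ltxx.
rewrite segment_next -/u' -/t' => wall0; exists S', f, b; split=> //=; split=> //.
set a := LM _ _ in neg dpos wall0 *; rewrite /wall.
move: wall0 dpos; rewrite !wdiff_segment.
set ds := wdiff ws a b; set dt := wdiff wt a b in neg *.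
move=> wall0 dpos.
have ds0 : 0 < ds by nra.
apply: (canRL (mulfK _)); first by rewrite subr_eq0 gt_eqF // (lt_trans neg).
by rewrite mulrBr; lra.
Qed.

Section Limit.
Variable x : R.
Hypotheses (x0 : 0 < x) (x1 : x <= 1).

(** The limit of the orderings [(W t, Mt)] as [t] tends to [x] from below, since
    [W t] is [W x] plus a small positive multiple of [ws - wt]. *)
Definition limit_ordering : rel 'X_{1..n.+1} :=
  refine (W x) (refine (ws - wt) (mxgt Mt)).

Lemma wdegm_sub (w w' : 'rV[R]_n.+1) a : wdegm (w - w') a = wdegm w a - wdegm w' a.
Proof. by rewrite -[w]scale1r -scaleN1r wdegm_lin scale1r mulN1r mul1r. Qed.

(** If [W x] vanishes on a monomial then so does [wt], because [0 < x], and on such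
    a monomial [ws - wt] is [ws], which is nonnegative. *)
Lemma limit_global : global_ordering limit_ordering.
Proof.
split=> [|a a0]; first by do 2!apply: refine_mo; exact: Mtglobal.1.
rewrite /limit_ordering /refine !wdegm0 (Mtglobal.2 _ a0) andbT orbC.
have s0 := ws_ge0 Msglobal a; have q0 := wt_ge0 Mtglobal a.
have Wx0 : 0 <= wdegm (W x) a by apply: (segment_ge0 Msglobal Mtglobal); rewrite x1 ltW.
move: Wx0; rewrite le_eqVlt => /predU1P [Wx|->]; last by rewrite orbT.
rewrite -Wx eqxx /= wdegm_sub; move: Wx; rewrite wdegm_lin => Wx.
have -> : wdegm wt a = 0 by apply: nneg_comb_eq0 (esym Wx); rewrite ?subr_ge0.
by rewrite subr0; move: s0; rewrite le_eqVlt => /orP [->|->]; rewrite ?orbT.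
Qed.

(** The difference of the weights of [a] and [b] is affine in [t], so its sign is
    constant just before [x]. *)
Lemma limit_near a b : exists2 e, 0 < e &
  forall t, x - e < t < x -> limit_ordering a b -> gtw t a b.
Proof.
pose D := wdiff (W x) a b; pose E := wdiff ws a b - wdiff wt a b.
have DE t : wdiff (W t) a b = D + (x - t) * E.
  by rewrite /D /E !wdiff_segment; ring.
have lt_wdiff (w : 'rV[R]_n.+1) : (wdegm w b < wdegm w a) = (0 < wdiff w a b).
  by rewrite /wdiff subr_gt0.
have eq_wdiff (w : 'rV[R]_n.+1) : (wdegm w b == wdegm w a) = (wdiff w a b == 0).
  by rewrite /wdiff subr_eq0 eq_sym.
have limE : limit_ordering a b =
    (0 < D) || ((D == 0) && ((0 < E) || ((E == 0) && mxgt Mt a b))).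
  rewrite /limit_ordering /refine !lt_wdiff !eq_wdiff -/D.
  by have -> : wdiff (ws - wt) a b = E by rewrite /wdiff !wdegm_sub /E /wdiff; ring.
have gtE t : gtw t a b = (0 < wdiff (W t) a b) || ((wdiff (W t) a b == 0) && mxgt Mt a b).
  by rewrite wgtE /refine lt_wdiff eq_wdiff.
have [D0|D0] := ltP 0 D.
  have E0 := normr_ge0 E; have El : - `|E| <= E := lerNnormlW (lexx _).
  exists (D / (1 + `|E|)) => [|t /andP [lt tx] _]; first by rewrite divr_gt0 // ltr_wpDr.
  rewrite gtE DE; have : (x - t) * (1 + `|E|) < D.
    by rewrite -ltr_pdivlMr ?ltr_wpDr //; lra.
  by move=> ?; rewrite (_ : 0 < _) //; nra.
exists 1 => // t /andP [_ tx]; rewrite limE gtE DE (le_gtF D0) /=.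
case/andP => /eqP -> /orP [E0|/andP [/eqP -> ->]].
  by rewrite add0r mulr_gt0 // subr_gt0.
by rewrite mulr0 addr0 eqxx orbT.
Qed.

(** The leading monomial of each element is decided by finitely many comparisons, so
    a common radius exists. *)
Lemma limit_sagbi (T : {fset {mpoly K[n.+1]}}) : sagbi_basis limit_ordering A [set` T] ->
  exists2 e, 0 < e & forall t, 0 <= t <= 1 -> x - e < t < x ->
    sagbi_basis (gtw t) A [set` T] /\
    forall f, f \in T -> f != 0 -> LM (gtw t) f = LM limit_ordering f.
Proof.
move=> Tlim; have limg := limit_global.
pose s := [seq (LM limit_ordering f, b) | f <- T, b <- msupp f].
have [e e0 eP] := uniform_radius s (fun p => limit_near p.1 p.2).
exists e => // t t01 /eP near; have gtg := wgt_global Msglobal Mtglobal t01.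
have LME f : f \in T -> f != 0 -> LM (gtw t) f = LM limit_ordering f.
  move=> Tf f0; apply: (LM_unique gtg.1); first exact: (LM_supp limg.1 f0).
  move=> b fb bf; apply: (near (_, b)); last exact: (LM_gt limg.1 fb bf).
  by apply/allpairsPdep; exists f, b.
split=> //; apply: (sagbi_transfer gtg Aalg _ limg.1 _ Tlim); first by case: Tlim.
exact: LME.
Qed.

End Limit.

(** Such a [b] is heavier than [a] at the end of the segment and lighter at [t],
    hence lighter at the earlier point [t1]: this bounds its coordinates of positive
    weight at [t1]. As [t1] is interior, the other coordinates have weight 0 along
    the whole segment, and the wall does not depend on them. *)
Lemma finitely_many_walls t1 (L : seq 'X_{1..n.+1}) : 0 < t1 < 1 ->
  exists V : seq R, forall a b t, a \in L -> t1 <= t -> t < 1 ->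
    wdiff wt a b < 0 -> 0 < wdiff (W t) a b -> wall a b \in V.
Proof.
move=> /andP [t10 t11]; pose C := \big[Num.max/0]_(a <- L) wdegm (W t1) a.
have w0 i : [/\ 0 <= ws 0 i, 0 <= wt 0 i & 0 <= W t1 0 i].
  have U (w : 'rV[R]_n.+1) : wdegm w U_(i)%MM = w 0 i.
    rewrite wdegmE (bigD1 i) //= mnm1E eqxx mulr1 big1 ?addr0 // => j ji.
    by rewrite mnm1E eq_sym (negbTE ji) mulr0.
  rewrite -!U; split; [exact: ws_ge0|exact: wt_ge0|].
  by apply: (segment_ge0 Msglobal Mtglobal); rewrite !ltW.
have [|N NP] := @bounded_exponents R n.+1 (W t1) C; first by move=> i; case: (w0 i).
(* Discard the coordinates that have weight 0 on the whole segment. *)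
pose cut (b : 'X_{1..n.+1}) := [multinom if W t1 0%R i == 0%R then 0%N else b i | i < n.+1].
have cutE (w : 'rV[R]_n.+1) b : (forall i, W t1 0 i = 0 -> w 0 i = 0) ->
    wdegm w (cut b) = wdegm w b.
  move=> wz; rewrite !wdegmE; apply: eq_bigr => i _; rewrite mnmE.
  by case: eqP => // /wz ->; rewrite !mul0r.
have coord0 i : W t1 0 i = 0 -> ws 0 i = 0 /\ wt 0 i = 0.
  have [wsi wti _] := w0 i; rewrite mxE [X in X + _]mxE [X in _ + X]mxE => Wi.
  split; last by apply: nneg_comb_eq0 Wi; rewrite // subr_ge0 ltW.
  by move: Wi; rewrite addrC; apply: nneg_comb_eq0; rewrite ?subr_gt0 // ltW.
exists [seq wall a b | a <- L, b <- [seq bmnm c | c <- enum {: 'X_{1..n.+1 < N}}]].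
move=> a b t La t1t tlt1 neg pos.
have -> : wall a b = wall a (cut b).
  by rewrite /wall /wdiff !cutE // => i /coord0 [].
have bN : (mdeg (cut b) < N)%N.
  apply: NP => [i Wi|]; first by rewrite mnmE Wi eqxx.
  rewrite cutE //; apply: le_trans (_ : wdegm (W t1) a <= _); last exact: le_bigmax_seq.
  move: pos; rewrite -subr_ge0 -/(wdiff _ _ _) !wdiff_segment.
  by set ds := wdiff ws a b; set dt := wdiff wt a b in neg *; nra.
apply/allpairsP; exists (a, cut b); split=> //=.
by apply/mapP; exists (BMultinom bN); rewrite ?mem_enum.
Qed.

(** All parameters with an infinite run lie strictly below their supremum [x]. Close
    to [x] each of them is followed by another one in a fixed finite set. *)
Lemma walk_terminates t : ~ nonterminating t.
Proof.
move=> tbad; pose B := [set s | nonterminating s].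
have Bsup : has_sup B.
  split; first by exists t.
  by exists 1 => s [S [[/andP [_ s1] _] _]].
set x := sup B.
have Blt s : nonterminating s -> s < x.
  move=> /nonterminating_next [s' [[Bs' ss' _] _]]; apply: lt_le_trans ss' _.
  exact: sup_upper_bound.
have B0 s : nonterminating s -> 0 <= s by move=> [S [[/andP [s0 _] _] _]].
have x0 : 0 < x by apply: le_lt_trans (Blt _ tbad); exact: B0.
have x1 : x <= 1.
  apply: sup_le_ub => [|s [S [[/andP [_ s1] _] _]]] //; by exists t.
have [T Tlim] := Afin (limit_global x0 x1).
have [e e0 eP] := limit_sagbi x0 x1 Tlim.
have [t1 Bt1 t1max] : exists2 t1, nonterminating t1 & Num.max (x - e) t < t1.
  have d0 : 0 < x - Num.max (x - e) t by rewrite subr_gt0 gt_max (Blt t) // andbT ltrBlDr ltrDl.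
  by have [t1 Bt1] := sup_adherent d0 Bsup; rewrite opprB addrC subrK; exists t1.
have /andP [et1 tt1] : (x - e < t1) && (t < t1) by rewrite -gt_max.
have t10 : 0 < t1 by apply: le_lt_trans tt1; exact: B0.
have t11 : t1 < 1 by apply: lt_le_trans (Blt _ Bt1) x1.
have [|V VP] := @finitely_many_walls t1 [seq LM (limit_ordering x) f | f <- T].
  by rewrite t10.
apply: (@no_finite_ascent _ V (fun s => nonterminating s /\ t1 <= s)) (conj Bt1 (lexx _)).
move=> s [Bs t1s]; have s1 : s < 1 by apply: lt_le_trans (Blt _ Bs) x1.
have [s' [[Bs' ss' _] [S [f [b [Ss Sred Sf [neg pos s'E]]]]]]] := nonterminating_next Bs.
have s01 : 0 <= s <= 1 by rewrite B0 // ltW.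
have sx : x - e < s < x by rewrite (Blt s) // andbT (lt_le_trans et1).
have [Tgt TLM] := eP s s01 sx.
exists s'; split=> //; first by split=> //; exact: le_trans (ltW ss').
rewrite s'E; apply: (VP _ _ s) => //.
have gtg := wgt_global Msglobal Mtglobal s01.
have f0 : f != 0 by apply: contraNneq Ss.2 => <-.
have [|g [/= Tg g0] <-] := interreduced_lmons Ss Sred Tgt (t := LM (gtw s) f).
  by exists f.
by rewrite TLM //; exact: map_f.
Qed.

End Termination.

Theorem theorem3p5 (R : realType) (K : fieldType) (n : nat)
    (A : set {mpoly K[n.+1]}) (Ms Mt : 'M[R]_n.+1)
    (Ss : {fset {mpoly K[n.+1]}}) :
  subalgebra A ->
  (forall gt : rel 'X_{1..n.+1}, global_ordering gt ->
     exists S : {fset {mpoly K[n.+1]}}, sagbi_basis gt A [set` S]) ->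
  Ms \in unitmx -> Mt \in unitmx ->
  global_ordering (mxgt Ms) -> global_ordering (mxgt Mt) ->
  sagbi_basis (mxgt Ms) A [set` Ss] -> monic_set (mxgt Ms) [set` Ss] ->
  let init := Running Ss (row 0 Ms) in
  [/\ terminates Mt init,
      forall (S : {fset {mpoly K[n.+1]}}) (w : 'rV[R]_n.+1),
        reachable Mt init (Running S w) ->
        exists st, step Mt (Running S w) st
    & forall Snew, reachable Mt init (Returned R Snew) ->
        sagbi_basis (mxgt Mt) A [set` Snew]].
Proof.
move=> Aalg Afin _ _ Msg Mtg Ssagbi _ init.
have wsE : row 0 Ms = segment Ms Mt 0 by rewrite /segment subr0 scale1r scale0r addr0.
have inv0 : invariant A Ms Mt Ss 0.
  rewrite /invariant lexx ler01 -wsE; split=> //.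
  by exists (mxgt Ms); split=> //; exact: mxgt_refines_row0.
have good0 : good A Ms Mt init by exists 0.
split=> [|S w /(reachable_good Aalg Msg Mtg)/(_ good0) [t -> Sinv]|S].
- rewrite /init wsE; apply: contrapT => nterm.
  by apply: (@walk_terminates R K n A Ms Mt Aalg Afin Msg Mtg 0); exists Ss.
- exact: progress Sinv.
- by move/(reachable_good Aalg Msg Mtg)/(_ good0).
Qed.
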